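(* Consider the model $$Y_i=T_ix_i\gamma+f_c+\epsilon_i,\qquad i=1,\dots,N,$$ where the normal (no-treatment) consumption $f_i=f_c$ is a constant, the treatment effect $g_i=x_i\gamma$ is linear in the scalar covariate $x_i$, and $\epsilon_i$ is the noise term of the regression model. Let $T_1,\dots,T_N$ be i.i.d. Bernoulli$(p)$ with $p\in(0,1)$, and suppose that the covariate $x_i$ follows a Gaussian distribution with mean $\mu\neq 0$ and unit variance. Let $\bar g=\frac1N\sum_i g_i$ be the average treatment effect, and let $\hat{\bar g}_{MCM}$, $\hat{\bar g}_{SLR}$, $\hat{\bar g}_{MLR}$ be its three estimators, with variances understood as described in the context. Then: (a) The variances of the estimators are $$\mathrm{Var}(\hat{\bar g}_{MCM}-\bar g)=\mathrm{Var}\Big((\hat\gamma-\gamma)\frac{\sum_i x_i}{N}\Big)\approx\frac{\gamma^2\mu^2p^2(3+\mu^2)}{Np(1-p)(1+\mu^2)^2},$$ $$\mathrm{Var}(\hat{\bar g}_{SLR}-\bar g)=\frac{(1-p)^2\gamma^2}{p(1-p)N},\qquad \mathrm{Var}(\hat{\bar g}_{MLR}-\bar g)=\frac{(2p-1)^2\gamma^2}{p(1-p)N}.$$ (b) The performances of the three estimators (a smaller variance being better) depend both on the value of $p$ and on $\mu$: MCM performs the best when $p$ is relatively small, SLR performs the best when $p$ is relatively large, and otherwise, when $p$ takes on moderate values between 0 and 1, MLR yields the best estimator of $\bar g$. That is, there are thresholds $0<p_1<p_2<1$ (depending on $\mu$) such that the smallest of the three variances is that of MCM for $p<p_1$, that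 of MLR for $p_1<p<p_2$, and that of SLR for $p>p_2$.
   Context: $Y_i$ is the observed consumption of sample $i$, $T_i$ is the binary treatment indicator (assigned independently of everything else), $x_i$ is a scalar covariate, $f_c$ is a constant baseline consumption, and $\gamma$ is a real coefficient. In the variance computations the $T_i$ are the only random variables; $f_i$, $g_i$ and $x_i$ take fixed values. The Gaussian assumption is used for the empirical moments of the covariates: $\mu=\frac1N\sum_i x_i$, $\frac1N\sum_i(x_i-\mu)^2=1$, and empirical moments up to order four are those of $\mathcal N(\mu,1)$. Estimators (all by ordinary least squares with intercept): - $\hat{\bar g}_{SLR}$ (simple linear regression): the coefficient of $T_i-p$ when $Y_i$ is regressed on $(T_i-p,\,1)$. - $\hat{\bar g}_{MLR}$ (multiple linear regression): the coefficient of $T_i-p$ when $Y_i$ is regressed on $(T_i-p,\,x_i,\,1)$. - $\hat{\bar g}_{MCM}$ (modified covariate method): $\hat{\bar g}_{MCM}=\frac1N\sum_i x_i\hat\gamma$, where $\hat\gamma$ is the coefficient of the modified covariate $(T_i-p)x_i$ when $Y_i$ is regressed on $((T_i-p)x_i,\,1)$. Approximation convention: in all variances, higher order terms are ignored and variances are approximated by their second order Taylor expansions (the delta method); for a ratio $X/Y$ with $\mathbb E X=0$ this means $\mathrm{Var}(X/Y)\approx \mathrm{Var}(X)/(\mathbb E Y)^2$. The equality signs in the SLR and MLR formulas are to be read under this same convention.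
   Formalization: Two thresholds fail when 10μ²+3μ⁴<1 and γ≠0 (e.g. μ=0.1, p=0.65: MCM beats MLR and SLR); there the result has p1<p2<p3 with MCM best again for p2<p<p3 and SLR for p>p3; if 10μ²+3μ⁴≥1, p2=p3 as claimed. *)

(* Defs.v *)
From HB Require Import structures.
From mathcomp Require Import all_boot all_order all_algebra.
From mathcomp Require Import all_classical all_reals all_analysis.
Set Implicit Arguments.
Unset Strict Implicit.
Unset Printing Implicit Defensive.
Import Order.TTheory GRing.Theory Num.Theory.
Import numFieldNormedType.Exports.
Local Open Scope classical_set_scope.
Local Open Scope ring_scope.

Definition mean (R : realType) (N : nat) (a : 'I_N -> R) : R :=
  (\sum_(i < N) a i) / N%:R.

(* Ordinary least squares, (X^T X)^-1 X^T y.  When the columns of X are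
   linearly dependent the minimiser is not unique and the value is set to 0;
   for the regressions below this only concerns events whose probability is
   exponentially small in N (such as "all units are treated"). *)
Definition ols (R : realType) (N k : nat) (X : 'M[R]_(N, k)) (y : 'cV[R]_N) :
    'cV[R]_k :=
  if X^T *m X \in unitmx then invmx (X^T *m X) *m (X^T *m y) else 0.

(* Least-squares coefficient of the regressor [r] when [y] is regressed on
   [r], the further regressors [cs], and an intercept. *)
Definition ols_coef (R : realType) (N : nat)
    (r : 'I_N -> R) (cs : seq ('I_N -> R)) (y : 'I_N -> R) : R :=
  ols (\matrix_(i < N, j < (size cs).+2)
         nth (fun=> 1) (r :: rcons cs (fun=> 1)) j i)
      (\col_(i < N) y i) ord0 ord0.

Section Estimators.
Context {R : realType}.
Variables (gamma fc p : R) (N : nat) (x : 'I_N -> R).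

(* [t] is the vector of treatment indicators, [e] the vector of noise terms. *)
Definition consumption (t : 'I_N -> bool) (e : 'I_N -> R) (i : 'I_N) : R :=
  (t i)%:R * x i * gamma + fc + e i.

Definition average_effect : R := mean (fun i => x i * gamma).

Definition gamma_hat (t : 'I_N -> bool) (e : 'I_N -> R) : R :=
  ols_coef (fun i => ((t i)%:R - p) * x i) [::] (consumption t e).

Inductive method := MCM | SLR | MLR.

Definition estimate (m : method) (t : 'I_N -> bool) (e : 'I_N -> R) : R :=
  match m with
  | MCM => mean (fun i => x i * gamma_hat t e)
  | SLR => ols_coef (fun i => (t i)%:R - p) [::] (consumption t e)
  | MLR => ols_coef (fun i => (t i)%:R - p) [:: x] (consumption t e)
  end.

End Estimators.

(* Mutual independence of finitely many random variables. *)
Definition mutually_independent (R : realType) (d d' : measure_display)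
    (Om : measurableType d) (E : measurableType d') (P : probability Om R)
    (I : finType) (X : I -> Om -> E) : Prop :=
  forall (J : {set I}) (B : I -> set E), (forall i, measurable (B i)) ->
    P (\bigcap_(i in [set` J]) X i @^-1` B i)
    = (\prod_(i in J) P (X i @^-1` B i))%E.

(* A randomised experiment on N units.  The covariates are fixed numbers whose
   empirical moments of order at most four agree with those of N(mu, 1).  The
   noise lives on a probability space of its own: treatment is assigned
   independently of it. *)
Record trial (R : realType) (p mu : R) (N : nat) := Trial {
  cov : 'I_N -> R;
  cov_mean : mean cov = mu;
  cov_moments : forall k, (k <= 4)%N ->
    ((mean (fun i => (cov i - mu) ^+ k))%:E
     = 'E_(normal_prob mu 1)[fun y : R => ((y - mu) ^+ k)%R])%E;
  treat_display : measure_display;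
  treat_space : measurableType treat_display;
  treat_prob : probability treat_space R;
  treat : 'I_N -> {RV treat_prob >-> bool};
  treat_indep :
    mutually_independent treat_prob (fun i => treat i : treat_space -> bool);
  treat_bernoulli : forall i,
    distribution treat_prob (treat i) = bernoulli_prob p :> (set bool -> \bar R);
  noise_display : measure_display;
  noise_space : measurableType noise_display;
  noise_prob : probability noise_space R;
  noise : 'I_N -> {RV noise_prob >-> R};
  noise_integrable : forall i,
    noise_prob.-integrable setT (EFin \o noise i);
  noise_centered : forall i, ('E_noise_prob[noise i] = 0)%E
}.

(* Variance of a statistic [h] when the treatment indicators are the only
   source of randomness: the noise is averaged out beforehand, so that its own
   contribution (the conditional variance given the treatments) is not
   counted. *)
Definition treatment_variance (R : realType) (p mu : R) (N : nat)
    (E : trial p mu N) (h : ('I_N -> bool) -> ('I_N -> R) -> R) : \bar R :=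
  variance (treat_prob E) (fun w =>
    fine (expectation (noise_prob E) (fun w' =>
      h (fun i => treat E i w) (fun i => noise E i w')))).

Definition error_variance (R : realType) (p mu : R) (N : nat)
    (E : trial p mu N) (gamma fc : R) (m : method) : \bar R :=
  treatment_variance E (fun t e =>
    estimate gamma fc p (cov E) m t e - average_effect gamma (cov E)).

Definition approx_variance (R : realType) (gamma mu p : R) (N : nat)
    (m : method) : R :=
  match m with
  | MCM => (gamma ^+ 2 * mu ^+ 2 * p ^+ 2 * (3 + mu ^+ 2))
           / (N%:R * p * (1 - p) * (1 + mu ^+ 2) ^+ 2)
  | SLR => ((1 - p) ^+ 2 * gamma ^+ 2) / (p * (1 - p) * N%:R)
  | MLR => ((2 * p - 1) ^+ 2 * gamma ^+ 2) / (p * (1 - p) * N%:R)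
  end.

(* [m] has the smallest variance.  When gamma = 0 all the variances vanish and
   ties are allowed; otherwise the inequalities are strict.  The first version
   compares the approximate variances, the second the exact ones for all
   large N. *)
Definition best_approx (R : realType) (mu gamma p : R) (m : method) : Prop :=
  forall N m', (0 < N)%N -> m' <> m ->
    approx_variance gamma mu p N m < approx_variance gamma mu p N m'
    ?<= if (gamma == 0).

Definition best_exact (R : realType) (mu gamma fc p : R) (m : method) : Prop :=
  \forall N \near \oo, forall (E : trial p mu N) m', m' <> m ->
    (error_variance E gamma fc m < error_variance E gamma fc m'
     ?<= if (gamma == 0))%O.

(* Main.v *)
Require Import Defs.
From HB Require Import structures.
From mathcomp Require Import all_boot all_order all_algebra.
From mathcomp Require Import all_classical all_reals all_analysis.
From mathcomp Require Import measurable_realfun ring lra.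
Set Implicit Arguments.
Unset Strict Implicit.
Unset Printing Implicit Defensive.
Import Order.TTheory GRing.Theory Num.Theory.
Import numFieldNormedType.Exports.
Local Open Scope classical_set_scope.
Local Open Scope ring_scope.

(** Every estimator is a quotient of empirical means, so for a given assignment
    its error is an explicit function of the three centred scores
    [mean (tau * z ^+ k)], [k = 0, 1, 2], where [tau i] is the treatment
    indicator minus [p] and [z i] the covariate minus [mu] ([slr_estimate],
    [mlr_estimate], [gamma_hatE]).  The noise disappears because a least-squares
    coefficient is a linear form in the response ([estimate_noise]).

    Each error has the shape [(a + r) / B], with [a] linear in the scores, [r]
    quadratic and [B] a constant [D] plus terms of order one in the scores.
    The delta method replaces it by [a / D], whose variance is exactly the
    announced expression ([approx_varianceE]: second and fourth empirical
    moments of the covariates, and [p * (1 - p)] for each indicator).  What has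
    to be justified is that the events on which [B] is small do not matter.
    The justification is pointwise: if the squared error never exceeds [M], then
    the squared difference between the error and [a / D] is at most
    [K * (1 + M)] times a quadratic form in the squared scores
    ([ratio_linearization_quadratic]), because [B] can only leave the
    neighbourhood of [D] when some score is bounded away from 0.  Scores have
    fourth moments of order [N ^- 2] ([Ex_mean4]), so any bound [M] that is
    small compared with [N] is enough.

    The bound is [M = O(sqrt N)].  For SLR and MLR the estimate is [gamma] times
    a convex combination of group means of the covariates, and the fourth moment
    forces [z i ^+ 2 <= 2 * sqrt N] ([slr_error_product],
    [mlr_error_product]).  For MCM the denominator is the empirical variance of
    the modified covariate; it could only vanish for covariates taking at most
    two values, which the first four normal moments exclude, quantitatively
    ([mean_square_quadratic], [mcm_error_product]).  Altogether [N] times the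
    variance differs from [N] times its approximation by an arbitrarily small
    multiple of a constant plus [O(1 / sqrt N)] ([noiseless_variance_limit]).

    Up to the common factor [gamma ^+ 2 / (p * (1 - p) * N)], the variances are
    the squares of [r * p], [1 - p] and [2 * p - 1], with
    [r = sqrt (mu ^+ 2 * (3 + mu ^+ 2)) / (1 + mu ^+ 2)] ([method_weight]).
    Comparing the absolute values of three affine functions of [p] gives the
    thresholds; MCM has a second interval of optimality, between [(2 - r)^-1]
    and [(1 + r)^-1], precisely when [r < 1 / 2]. *)

(** * Empirical means *)

Section Mean.
Context {R : realType} {N : nat}.
Implicit Types (a b : 'I_N -> R) (c : R).

Lemma eq_mean a b : a =1 b -> mean a = mean b.
Proof. by move=> ab; rewrite /mean (eq_bigr _ (fun i _ => ab i)). Qed.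

Lemma meanD a b : mean (fun i => a i + b i) = mean a + mean b.
Proof. by rewrite /mean big_split mulrDl. Qed.

Lemma meanZ c a : mean (fun i => c * a i) = c * mean a.
Proof. by rewrite /mean -mulr_sumr mulrA. Qed.

Lemma mean_cst c : (0 < N)%N -> mean (fun _ : 'I_N => c) = c.
Proof.
move=> N0; rewrite /mean sumr_const card_ord -[c *+ N]mulr_natr mulfK//.
by rewrite pnatr_eq0 -lt0n.
Qed.

Lemma mean_ge0 a : (forall i, 0 <= a i) -> 0 <= mean a.
Proof. by move=> a0; rewrite divr_ge0// sumr_ge0. Qed.

Lemma le_mean a b : (forall i, a i <= b i) -> mean a <= mean b.
Proof. by move=> ab; rewrite ler_wpM2r// ler_sum. Qed.

Lemma sum_mean a : (0 < N)%N -> \sum_i a i = N%:R * mean a.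
Proof. by move=> N0; rewrite mulrC divfK// pnatr_eq0 -lt0n. Qed.

End Mean.

Section MeanInequalities.
Context {R : realType} {N : nat}.
Implicit Types u v : 'I_N -> R.

Lemma mean_cauchy_schwarz u v :
  mean (fun i => u i * v i) ^+ 2
  <= mean (fun i => u i ^+ 2) * mean (fun i => v i ^+ 2).
Proof.
set c := mean (fun i => u i * v i); set A := mean _; set B := mean _.
have quad (a b : R) : 0 <= a ^+ 2 * A - 2 * a * b * c + b ^+ 2 * B.
  have : 0 <= mean (fun i => (a * u i - b * v i) ^+ 2) by apply: mean_ge0 => i; exact: sqr_ge0.
  rewrite (@eq_mean _ _ _ (fun i => a ^+ 2 * u i ^+ 2 + (- 2 * a * b * (u i * v i)
    + b ^+ 2 * v i ^+ 2))) => [|i]; last by ring.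
  by rewrite !meanD !meanZ -/A -/B -/c; lra.
(* The first two choices settle the case where one of [A], [B] is positive; *)
(* the last two give [c = 0] when both vanish. *)
have h1 := quad B c; have h2 := quad c A; have h3 := quad 1 1; have h4 := quad 1 (- 1).
have A0 : 0 <= A by apply: mean_ge0 => i; exact: sqr_ge0.
have B0 : 0 <= B by apply: mean_ge0 => i; exact: sqr_ge0.
rewrite leNgt; apply/negP => lt; have {}lt : 0 < c ^+ 2 - A * B by lra.
have Ale : A <= 0.
  rewrite leNgt; apply/negP => A1; have := mulr_gt0 A1 lt; lra.
have Ble : B <= 0.
  rewrite leNgt; apply/negP => B1; have := mulr_gt0 B1 lt; lra.
have c0 : c = 0 by lra.
by move: lt; rewrite c0 (_ : A = 0); lra.
Qed.

Lemma sqr_mean_le u : (0 < N)%N -> mean u ^+ 2 <= mean (fun i => u i ^+ 2).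
Proof.
move=> N0; have := mean_cauchy_schwarz u (fun=> 1).
rewrite expr1n mean_cst// mulr1 (@eq_mean _ _ (fun i => u i * 1) u) => [|i]; last by rewrite mulr1.
by [].
Qed.

(** The only way a single covariate is controlled: by an empirical moment. *)
Lemma le_sum_mean u i : (forall j, 0 <= u j) -> u i <= N%:R * mean u.
Proof.
move=> u0; rewrite -sum_mean; last exact: leq_ltn_trans (ltn_ord i).
by rewrite (bigD1 i)//= lerDl sumr_ge0.
Qed.

End MeanInequalities.

(** * Closed forms of least-squares coefficients *)

Section LeastSquares.
Context {R : realType} {N : nat}.

Lemma ols_linear k (X : 'M[R]_(N, k)) (c : R) (y1 y2 : 'cV[R]_N) :
  ols X (c *: y1 + y2) = c *: ols X y1 + ols X y2.
Proof.
rewrite /ols; case: ifP => _; last by rewrite scaler0 addr0.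
by rewrite !linearP.
Qed.

(** The Frisch-Waugh-Lovell theorem.  The row [om] expresses the residual of the
    first regressor on the others, [om *m X^T] is this residual, and the second
    hypothesis says that it is orthogonal to the other regressors, with squared
    norm [B].  When the other regressors are independent, the Gram matrix is
    singular exactly when [B = 0]; then [ols] is 0 by definition and the right-hand
    side is 0 because [x / 0 = 0], so that the formula covers the singular
    designs as well. *)
Lemma ols_frisch_waugh k (X : 'M[R]_(N, k.+1)) (y : 'cV[R]_N)
    (om : 'rV[R]_(k.+1)) (B : R) :
  om 0 0 = 1 -> om *m X^T *m X = B *: delta_mx 0 0 ->
  (forall v : 'rV[R]_(k.+1), v 0 0 = 0 -> v *m X^T *m X = 0 -> v = 0) ->
  ols X y 0 0 = (om *m X^T *m y) 0 0 / B.
Proof.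
move=> om0 omG inj; have Gsym : (X^T *m X)^T = X^T *m X.
  by rewrite trmx_mul trmxK.
rewrite /ols; case: ifPn => [Gu|].
  have B0 : B != 0.
    apply/eqP => B0; move: omG; rewrite B0 scale0r -mulmxA => omG.
    have := congr1 (mulmx^~ (invmx (X^T *m X))) omG.
    rewrite /= mulmxK// mul0mx => om_eq0.
    by move: om0; rewrite om_eq0 mxE => /esym/eqP; rewrite oner_eq0.
  set b := invmx _ *m _.
  have : om *m X^T *m X *m b = om *m X^T *m y.
    by rewrite -[om *m X^T *m X]mulmxA [LHS]mulmxA mulmxK// mulmxA.
  move: b => b; rewrite omG -scalemxAl -rowE => <-.
  by rewrite [in RHS]mxE [row _ _ _ _]mxE mulrC mulKf.
rewrite unitmxE unitfE negbK => /det0P[v v0 vG].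
suff -> : B = 0 by rewrite invr0 mulr0 mxE.
apply/eqP; apply: contraNT v0 => B0; apply/eqP/inj; last by rewrite -mulmxA.
have : v *m (X^T *m X) *m om^T = 0 by rewrite vG mul0mx.
rewrite -mulmxA -{1}Gsym -trmx_mul mulmxA omG linearZ /= => /matrixP/(_ 0 0).
rewrite -scalemxAr trmx_delta -colE [LHS]mxE [col _ _ _ _]mxE [RHS]mxE.
by move=> /eqP; rewrite mulf_eq0 (negbTE B0) => /eqP.
Qed.

End LeastSquares.

Section Regression.
Context {R : realType} {N : nat}.
Implicit Types (r x y : 'I_N -> R).

Lemma ols_coef_linear r (cs : seq ('I_N -> R)) (c : R) y1 y2 :
  ols_coef r cs (fun i => c * y1 i + y2 i)
  = c * ols_coef r cs y1 + ols_coef r cs y2.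
Proof.
rewrite /ols_coef; set X := (\matrix_(i, j) _).
have -> : \col_i (c * y1 i + y2 i) = c *: (\col_i y1 i) + \col_i y2 i.
  by apply/colP => i; rewrite !mxE.
by rewrite ols_linear !mxE.
Qed.

(** The coefficient is a linear form in the response whose weights depend on the
    regressors only; averaging over a centred noise therefore removes it. *)
Lemma ols_coef_sum r (cs : seq ('I_N -> R)) y :
  ols_coef r cs y = \sum_j y j * ols_coef r cs (fun i => (i == j)%:R).
Proof.
have lin0 : ols_coef r cs (fun=> 0) = 0.
  have := ols_coef_linear r cs (- 1) (fun=> 0) (fun=> 0).
  rewrite (_ : (fun i => _) = fun=> 0); first by rewrite mulN1r addNr.
  by apply/funext => i; rewrite mulr0 addr0.
have lin_sum (s : seq 'I_N) : ols_coef r cs (fun i => \sum_(j <- s) y j * (i == j)%:R)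
    = \sum_(j <- s) y j * ols_coef r cs (fun i => (i == j)%:R).
  elim: s => [|j s IH].
    by rewrite big_nil -[RHS]lin0; congr ols_coef; apply/funext => i; rewrite big_nil.
  rewrite big_cons -IH -ols_coef_linear; congr ols_coef.
  by apply/funext => i; rewrite big_cons.
rewrite -lin_sum; congr ols_coef; apply/funext => i.
rewrite (bigD1 i)//= eqxx mulr1 big1 ?addr0// => j ji.
by rewrite eq_sym (negbTE ji) mulr0.
Qed.

(** Covariance over variance; when the regressor is constant both sides are 0. *)
Lemma simple_ols_coef r y : (0 < N)%N ->
  ols_coef r [::] y = (mean (fun i => r i * y i) - mean r * mean y)
                      / (mean (fun i => r i ^+ 2) - mean r ^+ 2).
Proof.
move=> N0; have Nn0 : N%:R != 0 :> R by rewrite pnatr_eq0 -lt0n.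
set X := \matrix_(i < N, j < 2) nth (fun=> 1) [:: r; fun=> 1] j i.
pose om : 'rV[R]_2 := \row_j (if j == 0 then 1 else - mean r).
have omX i : (om *m X^T) 0 i = r i - mean r.
  by rewrite mxE !big_ord_recl big_ord0 !mxE /= addr0 mul1r mulr1.
set B := mean (fun i => r i ^+ 2) - mean r ^+ 2.
have -> : ols_coef r [::] y = (om *m X^T *m \col_i y i) 0 0 / (N%:R * B).
  apply: ols_frisch_waugh; first by rewrite mxE.
    apply/rowP => -[[|[|//]] jp]; rewrite [LHS]mxE.
      under eq_bigr do rewrite omX mxE /=.
      rewrite sum_mean// !mxE !eqxx /= mulr1; congr (_ * _).
      rewrite (@eq_mean _ _ _ (fun i => r i ^+ 2 + - mean r * r i)) => [|i]; last by ring.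
      by rewrite meanD meanZ /B; ring.
    under eq_bigr do rewrite omX mxE /=.
    rewrite sum_mean// !mxE /= (@eq_mean _ _ _ (fun i => r i + - mean r)) => [|i]; last by ring.
    by rewrite meanD mean_cst//; ring.
  move=> v v0 /rowP/(_ (Ordinal (isT : (1 < 2)%N))).
  rewrite [LHS]mxE; under eq_bigr do rewrite !mxE !big_ord_recl big_ord0 v0 !mxE /= mul0r add0r !mulr1 addr0.
  rewrite sum_mean// mean_cst// mxE => /eqP; rewrite mulf_eq0 (negbTE Nn0) /= => /eqP v1.
  apply/rowP => -[[|[|//]] jp]; rewrite mxE.
    by rewrite -[RHS]v0; congr (v _ _); apply: val_inj.
  by rewrite -[RHS]v1; congr (v _ _); apply: val_inj.
rewrite [X in X / _]mxE; under eq_bigr do rewrite omX mxE.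
rewrite sum_mean// invfM mulrACA mulfV// mul1r; congr (_ / _).
rewrite (@eq_mean _ _ _ (fun i => r i * y i + - mean r * y i)) => [|i]; last by ring.
by rewrite meanD meanZ mulNr.
Qed.

(** Since the covariate has unit variance, [b] is the slope of [r] on [x]; the
    quotient is the covariance of [y] with the residual of [r] over the variance
    of that residual. *)
Lemma adjusted_ols_coef r x y (mu : R) : (0 < N)%N ->
  mean x = mu -> mean (fun i => (x i - mu) ^+ 2) = 1 ->
  let b := mean (fun i => r i * (x i - mu)) in
  ols_coef r [:: x] y =
  (mean (fun i => r i * y i) - mean r * mean y - b * mean (fun i => (x i - mu) * y i))
  / (mean (fun i => r i ^+ 2) - mean r ^+ 2 - b ^+ 2).
Proof.
move=> N0 xmu xvar b; have Nn0 : N%:R != 0 :> R by rewrite pnatr_eq0 -lt0n.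
have z0 : mean (fun i => x i - mu) = 0 by rewrite meanD mean_cst// xmu subrr.
set X := \matrix_(i < N, j < 3) nth (fun=> 1) [:: r; x; fun=> 1] j i.
pose om : 'rV[R]_3 :=
  \row_j (if j == 0 then 1 else if j == 1 then - b else b * mu - mean r).
have omX i : (om *m X^T) 0 i = r i - mean r - b * (x i - mu).
  by rewrite mxE !big_ord_recl big_ord0 !mxE /=; ring.
set B := mean (fun i => r i ^+ 2) - mean r ^+ 2 - b ^+ 2.
have -> : ols_coef r [:: x] y = (om *m X^T *m \col_i y i) 0 0 / (N%:R * B).
  apply: ols_frisch_waugh; first by rewrite mxE.
    apply/rowP => -[[|[|[|//]]] jp]; rewrite [LHS]mxE.
    - under eq_bigr do rewrite omX mxE /=.
      rewrite sum_mean// !mxE !eqxx /= mulr1; congr (_ * _).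
      rewrite (@eq_mean _ _ _ (fun i => r i ^+ 2 + (- mean r * r i + - b * (r i * (x i - mu))))) => [|i]; last by ring.
      by rewrite !meanD !meanZ /B -/b; ring.
    - under eq_bigr do rewrite omX mxE /=.
      rewrite sum_mean// !mxE /=.
      rewrite (@eq_mean _ _ _ (fun i => (r i * (x i - mu) + (- b * (x i - mu) ^+ 2 + (- b * mu - mean r) * (x i - mu))) + (mu * r i + - (mu * mean r)))) => [|i]; last by ring.
      by rewrite !meanD !meanZ mean_cst// xvar z0 -/b; ring.
    under eq_bigr do rewrite omX mxE /=.
    rewrite sum_mean// !mxE /= (@eq_mean _ _ _ (fun i => (r i + - mean r) + - b * (x i - mu))) => [|i]; last by ring.
    by rewrite !meanD meanZ mean_cst// z0; ring.
  move=> v v0 vG.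
  pose j1 : 'I_3 := Ordinal (isT : (1 < 3)%N); pose j2 : 'I_3 := Ordinal (isT : (2 < 3)%N).
  have vX i : (v *m X^T) 0 i = v 0 j1 * x i + v 0 j2.
    rewrite mxE !big_ord_recl big_ord0 v0 !mxE /= mul0r add0r mulr1 addr0.
    by congr (v _ _ * _ + v _ _); apply: val_inj.
  move/rowP: vG => vG.
  have := vG j1; have := vG j2; rewrite !mxE.
  under eq_bigr do rewrite vX mxE /= mulr1.
  rewrite sum_mean// meanD meanZ mean_cst// xmu => /eqP.
  rewrite mulf_eq0 (negbTE Nn0) /= => /eqP e2.
  under eq_bigr do rewrite vX mxE /=.
  rewrite sum_mean// => /eqP; rewrite mulf_eq0 (negbTE Nn0) /= => /eqP.
  rewrite (@eq_mean _ _ _ (fun i => v 0 j1 * (x i - mu) ^+ 2 +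
    ((v 0 j1 * mu + (v 0 j1 * mu + v 0 j2)) * (x i - mu) + (v 0 j1 * mu + v 0 j2) * mu))) => [|i]; last by ring.
  rewrite !meanD !meanZ mean_cst// xvar z0 e2 mul0r mulr0 !addr0 mulr1 => v1.
  have v2 : v 0 j2 = 0 by rewrite -[RHS]e2 v1 mul0r add0r.
  apply/rowP => -[[|[|[|//]]] jp]; rewrite mxE.
  - by rewrite -[RHS]v0; congr (v _ _); apply: val_inj.
  - by rewrite -[RHS]v1; congr (v _ _); apply: val_inj.
  - by rewrite -[RHS]v2; congr (v _ _); apply: val_inj.
rewrite [X in X / _]mxE; under eq_bigr do rewrite omX mxE.
rewrite sum_mean// invfM mulrACA mulfV// mul1r; congr (_ / _).
rewrite (@eq_mean _ _ _ (fun i => r i * y i + (- mean r * y i + - b * ((x i - mu) * y i)))) => [|i]; last by ring.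
by rewrite !meanD !meanZ; ring.
Qed.

End Regression.

(** * The three estimators as functions of the assignment *)

Section Estimates.
Context {R : realType}.
Variables (gamma fc p mu : R) (N : nat) (x : 'I_N -> R) (t : 'I_N -> bool).
Hypothesis N0 : (0 < N)%N.
Let z i := x i - mu.
Hypotheses (x1 : mean x = mu) (z2 : mean (fun i => z i ^+ 2) = 1).
Let tau i : R := (t i)%:R - p.
(* The three centred scores through which the assignment enters: [q], [b], [h] *)
(* have mean 0 and standard deviation of order [N ^- (1 / 2)]. *)
Let q := mean tau.
Let b := mean (fun i => tau i * z i).
Let h := mean (fun i => tau i * z i ^+ 2).
Local Notation Y := (consumption gamma fc x t (fun=> 0)).

Let z1 : mean z = 0.
Proof. by rewrite /z meanD mean_cst// x1 subrr. Qed.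

(** A square of an indicator is the indicator, so [tau ^+ 2] is affine in [tau];
    this identity makes every quadratic mean below affine in the scores. *)
Lemma mean_treatment_sq :
  mean (fun i => tau i ^+ 2) = p * (1 - p) + (1 - 2 * p) * q.
Proof.
rewrite (@eq_mean _ _ _ (fun i => p * (1 - p) + (1 - 2 * p) * tau i)) => [|i].
  by rewrite meanD !meanZ !mean_cst// mulrA.
by rewrite /tau; case: (t i) => /=; ring.
Qed.

Let meanY : mean Y = gamma * (b + mu * q + p * mu) + fc.
Proof.
rewrite (@eq_mean _ _ _ (fun i => gamma * (tau i * z i) + (gamma * mu * tau i +
   (gamma * p * z i + (gamma * p * mu + fc))))) => [|i].
  by rewrite !meanD !meanZ !mean_cst// z1 -/q -/b; ring.
by rewrite /consumption /tau /z; ring.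
Qed.

Let mean_tauY : mean (fun i => tau i * Y i)
  = gamma * (1 - p) * (b + mu * q + p * mu) + fc * q.
Proof.
rewrite (@eq_mean _ _ _ (fun i => gamma * (1 - p) * (tau i * z i) +
   ((gamma * (1 - p) * mu + fc) * tau i +
   (gamma * (1 - p) * p * z i + gamma * (1 - p) * p * mu)))) => [|i].
  by rewrite !meanD !meanZ !mean_cst// z1 -/q -/b; ring.
by rewrite /consumption /tau /z; case: (t i) => /=; ring.
Qed.

Let mean_zY : mean (fun i => z i * Y i) = gamma * (h + mu * b + p).
Proof.
rewrite (@eq_mean _ _ _ (fun i => gamma * (tau i * z i ^+ 2) +
   (gamma * mu * (tau i * z i) +
   (gamma * p * z i ^+ 2 + (gamma * p * mu + fc) * z i)))) => [|i].
  by rewrite !meanD !meanZ z1 z2 -/h -/b; ring.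
by rewrite /consumption /tau /z; ring.
Qed.

Lemma slr_estimate : estimate gamma fc p x SLR t (fun=> 0) =
  gamma * (1 - p - q) * (b + mu * q + p * mu) / ((p + q) * (1 - p - q)).
Proof.
rewrite /= simple_ols_coef// mean_treatment_sq mean_tauY meanY -/q.
by congr (_ / _); ring.
Qed.

Lemma mlr_estimate : estimate gamma fc p x MLR t (fun=> 0) =
  gamma * ((1 - p - q) * (b + mu * q + p * mu) - b * (h + mu * b + p))
  / ((p + q) * (1 - p - q) - b ^+ 2).
Proof.
rewrite /= (adjusted_ols_coef _ _ N0 x1 z2) mean_treatment_sq mean_tauY meanY mean_zY -/q -/b.
by congr (_ / _); ring.
Qed.

Let mean_u : mean (fun i => tau i * x i) = b + mu * q.
Proof.
rewrite (@eq_mean _ _ _ (fun i => tau i * z i + mu * tau i)) => [|i].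
  by rewrite meanD meanZ.
by rewrite /z; ring.
Qed.

Lemma mean_modified_covariate_sq : mean (fun i => (tau i * x i) ^+ 2)
  = p * (1 - p) * (1 + mu ^+ 2) + (1 - 2 * p) * (h + 2 * mu * b + mu ^+ 2 * q).
Proof.
rewrite (@eq_mean _ _ _ (fun i => p * (1 - p) * z i ^+ 2 +
  (p * (1 - p) * 2 * mu * z i + (p * (1 - p) * mu ^+ 2 +
   ((1 - 2 * p) * (tau i * z i ^+ 2) + ((1 - 2 * p) * 2 * mu * (tau i * z i)
    + (1 - 2 * p) * mu ^+ 2 * tau i)))))) => [|i].
  by rewrite !meanD !meanZ !mean_cst// z1 z2 -/q -/b -/h; ring.
by rewrite /z /tau; case: (t i) => /=; ring.
Qed.

(** The numerator is displayed as [B] plus a linear combination of scores, so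
    that [gamma_hat - gamma] is visibly of first order. *)
Lemma gamma_hatE : let w := b + mu * q in
  let B := p * (1 - p) * (1 + mu ^+ 2) + (1 - 2 * p) * (h + 2 * mu * b + mu ^+ 2 * q) - w ^+ 2 in
  gamma_hat gamma fc p x t (fun=> 0) = gamma * (B + p * (h + mu * b)) / B.
Proof.
move=> w B; rewrite /gamma_hat simple_ols_coef// mean_modified_covariate_sq mean_u meanY -/w -/B.
congr (_ / _).
rewrite (@eq_mean _ _ _ (fun i => gamma * (1 - p) * (tau i * z i ^+ 2) +
  (gamma * (1 - p) * 2 * mu * (tau i * z i) + (gamma * (1 - p) * mu ^+ 2 * tau i
  + (gamma * (1 - p) * p * z i ^+ 2 + (gamma * (1 - p) * p * 2 * mu * z i
  + (gamma * (1 - p) * p * mu ^+ 2 + fc * (tau i * x i)))))))) => [|i].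
  by rewrite !meanD !meanZ !mean_cst// z1 z2 mean_u -/q -/b -/h /B /w; ring.
by rewrite /consumption /z /tau; case: (t i) => /=; ring.
Qed.

Lemma mcm_estimate t' e : estimate gamma fc p x MCM t' e = mu * gamma_hat gamma fc p x t' e.
Proof.
rewrite /= (@eq_mean _ _ _ (fun i => gamma_hat gamma fc p x t' e * x i)) => [|i].
  by rewrite meanZ x1 mulrC.
by rewrite mulrC.
Qed.

End Estimates.

Section NoiseFree.
Context {R : realType}.
Variables (gamma fc p : R) (N : nat) (x : 'I_N -> R) (t : 'I_N -> bool).

Let ols_coef_noise r cs : exists a : 'I_N -> R, forall e,
  ols_coef r cs (consumption gamma fc x t e)
  = \sum_i a i * e i + ols_coef r cs (consumption gamma fc x t (fun=> 0)).
Proof.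
exists (fun j => ols_coef r cs (fun i => (i == j)%:R)) => e.
rewrite ols_coef_sum [in RHS]ols_coef_sum -big_split.
by apply: eq_bigr => j _ /=; rewrite /consumption addr0; ring.
Qed.

Lemma estimate_noise m : exists a : 'I_N -> R, forall e,
  estimate gamma fc p x m t e
  = \sum_i a i * e i + estimate gamma fc p x m t (fun=> 0).
Proof.
case: m => /=; [|exact: ols_coef_noise|exact: ols_coef_noise].
have [a aE] := ols_coef_noise (fun i => ((t i)%:R - p) * x i) [::].
exists (fun j => mean x * a j) => e; rewrite /gamma_hat aE.
set g := ols_coef _ _ _.
rewrite (@eq_mean _ _ _ (fun i => (\sum_j a j * e j + g) * x i)) => [|i]; last by rewrite mulrC.
rewrite (@eq_mean _ _ (fun i => x i * g) (fun i => g * x i)) => [|i]; last by rewrite mulrC.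
rewrite !meanZ mulrDl mulr_suml; congr (_ + _).
by apply: eq_bigr => i _; rewrite mulrC mulrA.
Qed.

End NoiseFree.

(** * Moments of the normal law *)

Section GaussianMoments.
Context {R : realType}.
Variable m : R.
Local Notation leb := (@lebesgue_measure R).
Local Notation phi := (normal_pdf m (1 : R)).

Let ge0_integral_normal_prob (f : R -> R) : (forall x, 0 <= f x) ->
  measurable_fun setT f ->
  (\int[normal_prob m 1]_x (f x)%:E = \int[leb]_x (f x * phi x)%:E)%E.
Proof.
move=> f0 mf.
have dom := @normal_prob_dominates R m 1.
rewrite -(Radon_Nikodym_SigmaFinite.change_of_variables dom)//; last exact/measurable_EFinP.
under [RHS]eq_integral do rewrite EFinM.
have RNint := Radon_Nikodym_SigmaFinite.f_integrable dom.
apply: ae_eq_integral => //.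
- apply: emeasurable_funM; first exact/measurable_EFinP.
  exact: measurable_int RNint.
- apply: emeasurable_funM; apply/measurable_EFinP => //.
  exact: measurable_normal_pdf.
- apply: ae_eqe_mul2l; apply: integral_ae_eq => //.
    by apply/measurable_EFinP; exact: measurable_normal_pdf.
  by move=> A _ mA; rewrite -Radon_Nikodym_SigmaFinite.f_integral.
Qed.

Let phiE y : phi y = normal_peak 1 * expR (- ((y - m) ^+ 2 / 2)).
Proof. by rewrite normal_pdfE ?oner_neq0// /normal_fun expr1n mulNr. Qed.

Let is_derive_horner (q : {poly R}) (y : R) :
  is_derive y 1 (horner q) q^`().[y].
Proof. by apply: DeriveDef; [exact: derivable_horner|rewrite -derive1E -derivE]. Qed.

(** The density is a multiple of [expR \o q] with [q] a quadratic polynomial. *)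
Let is_derive_phi (y : R) : is_derive y 1 phi (- (y - m) * phi y).
Proof.
pose q : {poly R} := (- 2^-1) *: ('X - m%:P) ^+ 2.
have -> : phi = normal_peak 1 *: (expR \o horner q).
  apply/funext => x; rewrite phiE /q; congr (_ * expR _).
  by rewrite !hornerE /=; field.
have h := is_deriveZ (normal_peak 1) (is_derive1_comp (is_derive_expR q.[y]) (is_derive_horner q y)).
apply: (is_derive_eq h).
have -> : q^`().[y] = - (y - m).
  by rewrite /q derivZ deriv_exp derivXsubC mul1r !hornerE /=; field.
rewrite [RHS](_ : _ = - (y - m) * (normal_peak 1 * expR q.[y]))//.
by rewrite [LHS](_ : _ = normal_peak 1 * (expR q.[y] * - (y - m)))//; ring.
Qed.

(** The term of index [k.+1] in the exponential series of [n ^+ 2 / 2] exceeds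
    [n ^+ k] by a factor of order [n ^+ k.+2]. *)
Let cvg_expn_gauss (k : nat) :
  (n%:R ^+ k * expR (- (n%:R ^+ 2 / 2)) : R) @[n --> \oo] --> (0 : R).
Proof.
pose C : R := (k.+1)`!%:R * 2 ^+ k.+1.
rewrite -cvg_shiftS /=.
apply: (@squeeze_cvgr _ _ _ _ (cst 0) (fun n => C * harmonic n)).
- apply: nearW => n; rewrite /= mulr_ge0 ?exprn_ge0 ?expR_ge0//=.
  have n0 : 0 < n.+1%:R :> R by [].
  rewrite expRN ler_pdivrMr ?expR_gt0//.
  have := @expR_ge1Dxn R (n.+1%:R ^+ 2 / 2) k (divr_ge0 (sqr_ge0 _) (ler0n _ 2)).
  set e := expR _ => he.
  have {he} he : (n.+1%:R ^+ 2 / 2) ^+ k.+1 / (k.+1)`!%:R <= e.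
    by apply: le_trans he; rewrite lerDr.
  have : n.+1%:R ^+ 2 ^+ k.+1 <= C * e.
    move: he; rewrite ler_pdivrMr ?ltr0n ?fact_gt0// expr_div_n ler_pdivrMr ?exprn_gt0//.
    by rewrite /C; congr (_ <= _); ring.
  rewrite -exprM => {}he; rewrite /harmonic mulrAC ler_pdivlMr// -exprSr.
  apply: le_trans he; apply: ler_weXn2l; first by rewrite ler1n.
  by rewrite mul2n -addnn leq_addr.
- exact: cvg_cst.
- rewrite -[X in _ --> X](mulr0 C); apply: cvgMl_tmp; exact: cvg_harmonic.
Qed.

Let cvg_poly_gauss (q : {poly R}) :
  (q.[n%:R] * expR (- (n%:R ^+ 2 / 2)) : R) @[n --> \oo] --> (0 : R).
Proof.
rewrite (_ : (fun n => _) = (fun n : nat =>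
  \sum_(i < size q) q`_i * (n%:R ^+ i * expR (- (n%:R ^+ 2 / 2))))); last first.
  apply/funext => n; rewrite horner_coef mulr_suml.
  by apply: eq_bigr => i _; rewrite mulrA.
elim: (size q) => [|k IH]; first by under eq_fun do rewrite big_ord0; exact: cvg_cst.
under eq_fun do rewrite big_ord_recr /=.
have := cvgD IH (cvgMl_tmp (a := q`_k) (cvg_expn_gauss k)).
by rewrite mulr0 addr0; exact.
Qed.

Let stein_cvg (F : {poly R}) : (F.[m + n%:R] * phi (m + n%:R)
   - F.[m - n%:R] * phi (m - n%:R) : R) @[n --> \oo] --> (0 : R).
Proof.
pose c : R := normal_peak 1.
pose Fr := c *: ((F \Po (m%:P + 'X)) - (F \Po (m%:P - 'X))).
rewrite (_ : (fun n => _) = fun n : nat => Fr.[n%:R] * expR (- (n%:R ^+ 2 / 2))).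
  exact: cvg_poly_gauss.
apply/funext => n; rewrite !phiE -/c /Fr !hornerE !horner_comp !hornerE /=.
rewrite (_ : m + n%:R - m = n%:R); last by ring.
rewrite (_ : (m - n%:R - m) ^+ 2 = n%:R ^+ 2); last by ring.
by ring.
Qed.

Let cont_poly_phi (q : {poly R}) : continuous (fun y => q.[y] * phi y).
Proof.
move=> y; apply: cvgM; first exact: continuous_horner.
by apply: continuous_normal_pdf; exact: oner_neq0.
Qed.

Let integral_segments (q : {poly R}) : (forall y, 0 <= q.[y]) ->
  (\int[leb]_(y in `[(m - n%:R)%R, (m + n%:R)%R]) (q.[y] * phi y)%:E @[n --> \oo]
   --> \int[leb]_y (q.[y] * phi y)%:E)%E.
Proof.
move=> q0.
have -> : [set: R] = \bigcup_n `[m - n%:R, m + n%:R]%classic.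
  apply/esym/seteqP; split => // y _.
  have [n yn] : exists n : nat, `|y - m| <= n%:R.
    by exists (Num.truncn `|y - m|).+1; rewrite ltW// truncnS_gt.
  exists n => //=; rewrite in_itv /=.
  by move: yn; rewrite ler_norml => /andP[? ?]; apply/andP; split; lra.
apply: ge0_nondecreasing_set_cvg_integral.
- move=> i j ij; rewrite subsetEset; apply: subset_itv; rewrite bnd_simp.
    by rewrite lerD2l lerN2 ler_nat.
  by rewrite lerD2l ler_nat.
- by [].
- move=> n; apply/measurable_EFinP/measurable_funTS.
  exact: continuous_measurable_fun.
- by move=> n y _; rewrite lee_fin mulr_ge0// normal_pdf_ge0.
Qed.

(** Stein's identity: [(F' - (y - m) * F) * phi] is the derivative of [F * phi],
    which vanishes at infinity.  Stating it between two nonnegative polynomials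
    avoids any integrability hypothesis: integrate over [m - n, m + n] and let [n]
    grow, by monotone convergence on both sides. *)
Lemma gaussian_stein (P Q F : {poly R}) :
  (forall y, 0 <= P.[y]) -> (forall y, 0 <= Q.[y]) ->
  P = Q + F^`() - ('X - m%:P) * F ->
  ('E_(normal_prob m 1)[fun y => P.[y]] = 'E_(normal_prob m 1)[fun y => Q.[y]])%E.
Proof.
move=> P0 Q0 PQF; rewrite unlock.
have mpoly (q : {poly R}) : measurable_fun setT (fun y => q.[y]).
  by apply: continuous_measurable_fun; exact: continuous_horner.
rewrite !ge0_integral_normal_prob//.
pose G y := F.[y] * phi y.
pose g y := (F^`() - ('X - m%:P) * F).[y] * phi y.
have dG (y : R) : is_derive y 1 G (g y).
  have h := is_deriveM (is_derive_horner F y) (is_derive_phi y).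
  apply: (is_derive_eq h); rewrite /GRing.scale /= /g !hornerE /=; ring.
have stein n : (\int[leb]_(y in `[(m - n.+1%:R)%R, (m + n.+1%:R)%R]) (P.[y] * phi y)%:E =
    \int[leb]_(y in `[(m - n.+1%:R)%R, (m + n.+1%:R)%R]) (Q.[y] * phi y)%:E +
    (G (m + n.+1%:R) - G (m - n.+1%:R))%R%:E)%E.
  have mn : m - n.+1%:R < m + n.+1%:R.
    by rewrite ltrD2l (@lt_trans _ _ 0)// oppr_lt0.
  rewrite EFinB -(@continuous_FTC2 _ g G)//; first last.
  - by move=> y _; rewrite derive1E; have := dG y => -[_ ->].
  - have cG (y : R) : {for y, continuous G}.
      by apply: differentiable_continuous; apply/derivable1_diffP; have := dG y => -[].
    split; first by move=> y _; have := dG y => -[].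
    + by apply: cvg_at_right_filter; exact: cG.
    + by apply: cvg_at_left_filter; exact: cG.
  - by apply: continuous_subspaceT; exact: cont_poly_phi.
  rewrite -integralD//=.
  - by apply: eq_integral => y _; rewrite -EFinD PQF /g -mulrDl -hornerD addrA.
  - apply: continuous_compact_integrable; first exact: segment_compact.
    by apply: continuous_subspaceT; exact: cont_poly_phi.
  - apply: continuous_compact_integrable; first exact: segment_compact.
    by apply: continuous_subspaceT; exact: cont_poly_phi.
have cP := integral_segments P0; rewrite -cvg_shiftS in cP.
have cQ := integral_segments Q0; rewrite -cvg_shiftS in cQ.
have cG := stein_cvg F; rewrite -cvg_shiftS in cG.
have cGE : (G (m + n.+1%:R) - G (m - n.+1%:R))%:E @[n --> \oo] --> (0 : R)%:E.
  by apply: cvg_EFin; [exact: nearW|exact: cG].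
have cQG := cvgeD (fin_num_adde_defl _ (isT : (0 : R)%:E \is a fin_num)) cQ cGE.
rewrite adde0 in cQG.
suff cPQ : (\int[leb]_(y in `[(m - n.+1%:R)%R, (m + n.+1%:R)%R]) (P.[y] * phi y)%:E
    @[n --> \oo] --> \int[leb]_y (Q.[y] * phi y)%:E)%E by exact: (cvg_unique _ cP cPQ).
rewrite (funext stein); exact: cQG.
Qed.

End GaussianMoments.

Section NormalMoments.
Context {R : realType}.
Variable m : R.

Let stein_cst (P F : {poly R}) (c : R) : (forall y, 0 <= P.[y]) -> 0 <= c ->
  P = c%:P + F^`() - ('X - m%:P) * F ->
  ('E_(normal_prob m 1)[fun y => P.[y]] = c%:E)%E.
Proof.
move=> P0 c0 PF; rewrite (gaussian_stein P0 _ PF) => [|y]; last by rewrite hornerC.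
by rewrite -[RHS](expectation_cst (normal_prob m 1)); congr expectation;
  apply/funext => y; rewrite hornerC.
Qed.

Let derivEs := (derivN, derivD, derivZ, deriv_exp, derivC, derivXsubC, derivX).

Lemma gaussian_moment2 : ('E_(normal_prob m 1)[fun y : R => ((y - m) ^+ 2)%R] = 1%:E)%E.
Proof.
rewrite -(@stein_cst (('X - m%:P) ^+ 2) (- ('X - m%:P)) 1)//.
- by congr expectation; apply/funext => y; rewrite horner_exp !hornerE.
- by move=> y; rewrite horner_exp sqr_ge0.
- by rewrite !derivEs; ring.
Qed.

Lemma gaussian_moment4 : ('E_(normal_prob m 1)[fun y : R => ((y - m) ^+ 4)%R] = 3%:E)%E.
Proof.
rewrite -(@stein_cst (('X - m%:P) ^+ 4) (- ('X - m%:P) ^+ 3 - 3%:P * ('X - m%:P)) 3)//.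
- by congr expectation; apply/funext => y; rewrite horner_exp !hornerE.
- by move=> y; rewrite horner_exp exprn_even_ge0.
- by rewrite !derivEs !derivM !derivEs polyC_natr /=; ring.
Qed.

Let integrable_poly (P F : {poly R}) (c : R) : (forall y, 0 <= P.[y]) -> 0 <= c ->
  P = c%:P + F^`() - ('X - m%:P) * F ->
  (fun y => P.[y]) \in Lfun (normal_prob m 1) 1.
Proof.
move=> P0 c0 PF; have := stein_cst P0 c0 PF; rewrite unlock => EP.
apply/Lfun1_integrable/integrableP; split.
  by apply/measurable_EFinP; apply: continuous_measurable_fun; exact: continuous_horner.
under eq_integral do rewrite /= ger0_norm//.
by rewrite EP ltry.
Qed.

(** An odd moment is not the integral of a nonnegative polynomial; it is obtained
    as the difference of those of [x ^+ 2 + x ^+ 3 + x ^+ 4] and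
    [x ^+ 2 + x ^+ 4], both nonnegative and both of expectation 4. *)
Lemma gaussian_moment3 : ('E_(normal_prob m 1)[fun y : R => ((y - m) ^+ 3)%R] = 0%:E)%E.
Proof.
pose x : {poly R} := 'X - m%:P.
pose P := x ^+ 2 + x ^+ 3 + x ^+ 4; pose Q := x ^+ 2 + x ^+ 4.
pose FQ := - x ^+ 3 - 3%:P * x - x; pose FP := FQ - x ^+ 2 - 2%:P.
have P0 y : 0 <= P.[y].
  rewrite !hornerD !horner_exp !hornerE /=.
  have -> : (y - m) ^+ 2 + (y - m) ^+ 3 + (y - m) ^+ 4
    = (y - m) ^+ 2 * ((1/2 + (y - m)) ^+ 2 + 3/4) by field.
  by rewrite mulr_ge0 ?sqr_ge0// addr_ge0 ?sqr_ge0// divr_ge0.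
have Q0 y : 0 <= Q.[y].
  by rewrite !hornerD !horner_exp !hornerE /= addr_ge0// exprn_even_ge0.
have PE : P = 4%:P + FP^`() - x * FP.
  by rewrite /P /FP /FQ /x !derivEs !derivM !derivEs !polyC_natr /=; ring.
have QE : Q = 4%:P + FQ^`() - x * FQ.
  by rewrite /Q /FQ /x !derivEs !derivM !derivEs !polyC_natr /=; ring.
have c0 : (0 : R) <= 4 by [].
have -> : (fun y : R => (y - m) ^+ 3) = (fun y => P.[y]) \- (fun y => Q.[y]).
  by apply/funext => y /=; rewrite /P /Q /x !hornerD !horner_exp !hornerE /=; ring.
rewrite expectationB ?(integrable_poly P0 c0 PE) ?(integrable_poly Q0 c0 QE)//.
by rewrite (stein_cst P0 c0 PE) (stein_cst Q0 c0 QE) -EFinB subrr.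
Qed.

End NormalMoments.

(** * Independent Bernoulli indicators *)

Section BernoulliVector.
Context {R : realType}.
Variables (p : R) (I : finType).
Hypothesis p01 : 0 <= p <= 1.
Implicit Types (f : {ffun I -> bool}) (F G : {ffun I -> bool} -> R).

Definition bernoulli_weight f : R := \prod_i bernoulli_pmf p (f i).

(** The expectation of a statistic of [#|I|] independent Bernoulli indicators. *)
Definition Ex F : R := \sum_f bernoulli_weight f * F f.

Definition set_coord (i : I) (b : bool) f : {ffun I -> bool} :=
  [ffun j => if j == i then b else f j].

Lemma bernoulli_weight_ge0 f : 0 <= bernoulli_weight f.
Proof. by apply: prodr_ge0 => i _; exact: bernoulli_pmf_ge0. Qed.

Lemma sum_bernoulli_weight : \sum_f bernoulli_weight f = 1.
Proof.
rewrite -(bigA_distr_bigA (fun _ : I => bernoulli_pmf p)) big1// => i _.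
by rewrite big_bool /= subrKC.
Qed.

Lemma ExD F G : Ex (fun f => F f + G f) = Ex F + Ex G.
Proof. by rewrite -big_split; apply: eq_bigr => f _; rewrite mulrDr. Qed.

Lemma ExZ c F : Ex (fun f => c * F f) = c * Ex F.
Proof. by rewrite mulr_sumr; apply: eq_bigr => f _; rewrite mulrCA. Qed.

Lemma Ex_cst c : Ex (fun=> c) = c.
Proof. by rewrite /Ex -mulr_suml sum_bernoulli_weight mul1r. Qed.

Lemma le_Ex F G : (forall f, F f <= G f) -> Ex F <= Ex G.
Proof. by move=> FG; apply: ler_sum => f _; rewrite ler_wpM2l// bernoulli_weight_ge0. Qed.

Lemma Ex_ge0 F : (forall f, 0 <= F f) -> 0 <= Ex F.
Proof. by move=> F0; rewrite -(Ex_cst 0); exact: le_Ex. Qed.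

Lemma eq_Ex F G : F =1 G -> Ex F = Ex G.
Proof. by move=> FG; apply: eq_bigr => f _; rewrite FG. Qed.

(** Resampling one indicator does not change the law: exchanging the old and the
    new value of the coordinate is an involution on pairs (vector, new value)
    which preserves the product weight. *)
Lemma Ex_resample i F :
  Ex F = Ex (fun f => p * F (set_coord i true f) + (1 - p) * F (set_coord i false f)).
Proof.
pose wt (u : {ffun I -> bool} * bool) := bernoulli_weight u.1 * bernoulli_pmf p u.2.
pose swap (u : {ffun I -> bool} * bool) := (set_coord i u.2 u.1, u.1 i).
have swapK : involutive swap.
  move=> [f b]; rewrite /swap /=; congr pair; last by rewrite ffunE eqxx.
  by apply/ffunP => j; rewrite !ffunE; case: eqP => // ->.
have wt_swap u : wt (swap u) = wt u.
  case: u => f b; rewrite /wt /= /bernoulli_weight (bigD1 i)//= [in RHS](bigD1 i)//=.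
  rewrite ffunE eqxx.
  have -> : \prod_(j | j != i) bernoulli_pmf p (set_coord i b f j)
          = \prod_(j | j != i) bernoulli_pmf p (f j).
    by apply: eq_bigr => j ji; rewrite ffunE (negbTE ji).
  by rewrite mulrAC [RHS]mulrAC; congr (_ * _); rewrite mulrC.
have lhs : \sum_u wt u * F u.1 = Ex F.
  rewrite -(pair_big xpredT xpredT (fun f b => wt (f, b) * F f)) /=.
  apply: eq_bigr => f _; rewrite big_bool /wt /=; ring.
rewrite -lhs (reindex_inj (inv_inj swapK)) /=.
under eq_bigr do rewrite wt_swap.
rewrite -(pair_big xpredT xpredT (fun f b => wt (f, b) * F (set_coord i b f))) /=.
by apply: eq_bigr => f _; rewrite big_bool /wt /=; ring.
Qed.

(** Independence of one indicator from a statistic of the others. *)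
Lemma Ex_indep i (g : bool -> R) F : (forall b f, F (set_coord i b f) = F f) ->
  Ex (fun f => g (f i) * F f) = (p * g true + (1 - p) * g false) * Ex F.
Proof.
move=> Fi; rewrite (Ex_resample i) -ExZ; apply: eq_Ex => f.
by rewrite !Fi !ffunE !eqxx; ring.
Qed.

Section LinearStatistic.
Variable c : I -> R.

Let X (s : seq I) f := \sum_(i <- s) c i * ((f i)%:R - p).
Let V (s : seq I) := \sum_(i <- s) c i ^+ 2.

Let X_set_coord i s b f : i \notin s -> X s (set_coord i b f) = X s f.
Proof.
move=> si; apply: eq_big_seq => j js; rewrite ffunE.
by case: eqP => // ji; move: si; rewrite -ji js.
Qed.

Lemma Ex_linear (s : seq I) : uniq s -> Ex (X s) = 0.
Proof.
elim: s => [_|i s IH /= /andP[si us]].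
  by rewrite /X; under eq_Ex do rewrite big_nil; rewrite Ex_cst.
rewrite /X; under eq_Ex do rewrite big_cons.
rewrite ExD IH// addr0 ExZ.
under eq_Ex do rewrite -[_ - p]mulr1.
by rewrite (Ex_indep (fun b : bool => b%:R - p))// Ex_cst /=; ring.
Qed.

Lemma Ex_linear2 (s : seq I) : uniq s ->
  Ex (fun f => X s f ^+ 2) = p * (1 - p) * V s.
Proof.
elim: s => [_|i s IH /= /andP[si us]].
  rewrite /X /V big_nil mulr0.
  by under eq_Ex do rewrite big_nil expr0n; rewrite Ex_cst.
rewrite /V big_cons mulrDr -/(V s) -(IH us).
have -> : Ex (fun f => X (i :: s) f ^+ 2) =
  c i ^+ 2 * Ex (fun f => ((f i)%:R - p) ^+ 2 * 1)
  + (2 * c i * Ex (fun f => ((f i)%:R - p) * X s f) + Ex (fun f => X s f ^+ 2)).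
  rewrite -!ExZ -!ExD; apply: eq_Ex => f.
  by rewrite [X (i :: s) f]big_cons -/(X s f); ring.
rewrite (Ex_indep (fun b : bool => (b%:R - p) ^+ 2))//.
rewrite (Ex_indep (fun b : bool => b%:R - p)) => [|b f]; last exact: X_set_coord.
by rewrite Ex_linear// Ex_cst /=; ring.
Qed.

(** Of the five terms of the expansion in the new summand, the two of odd degree
    vanish because the old sum and the new indicator are centred.  With [u] the
    new squared coefficient and [v] the sum of the old ones, the others add up to
    at most [u ^+ 2 + 6 * u * v + 3 * v ^+ 2]. *)
Lemma Ex_linear4 (s : seq I) : uniq s ->
  Ex (fun f => X s f ^+ 4) <= 3 * V s ^+ 2.
Proof.
elim: s => [_|i s IH /= /andP[si us]].
  rewrite /X /V big_nil expr0n mulr0.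
  by under eq_Ex do rewrite big_nil expr0n; rewrite Ex_cst.
have -> : Ex (fun f => X (i :: s) f ^+ 4) =
  c i ^+ 4 * Ex (fun f => ((f i)%:R - p) ^+ 4 * 1)
  + (4 * c i ^+ 3 * Ex (fun f => ((f i)%:R - p) ^+ 3 * X s f)
  + (6 * c i ^+ 2 * Ex (fun f => ((f i)%:R - p) ^+ 2 * X s f ^+ 2)
  + (4 * c i * Ex (fun f => ((f i)%:R - p) * X s f ^+ 3) + Ex (fun f => X s f ^+ 4)))).
  rewrite -!ExZ -!ExD; apply: eq_Ex => f.
  by rewrite [X (i :: s) f]big_cons -/(X s f); ring.
rewrite (Ex_indep (fun b : bool => (b%:R - p) ^+ 4))//.
rewrite (Ex_indep (fun b : bool => (b%:R - p) ^+ 3)) => [|b f]; last exact: X_set_coord.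
rewrite (Ex_indep (fun b : bool => (b%:R - p) ^+ 2)) => [|b f]; last by rewrite X_set_coord.
rewrite (Ex_indep (fun b : bool => b%:R - p)) => [|b f]; last by rewrite X_set_coord.
rewrite Ex_linear// Ex_linear2// Ex_cst /V big_cons -/(V s).
have {}IH := IH us; have V0 : 0 <= V s by apply: sumr_ge0 => j _; exact: sqr_ge0.
have c0 := sqr_ge0 (c i); move: IH; set e := Ex _ => IH; move/andP: p01 => [p0 p1] /=.
have q0 : 0 <= 1 - p by rewrite subr_ge0.
have q1 : 1 - p <= 1 by rewrite lerBlDr lerDl.
rewrite (_ : (0 - p) ^+ 4 = p ^+ 4); last by ring.
rewrite (_ : (0 - p) ^+ 2 = p ^+ 2); last by ring.
have h1 : p * (1 - p) ^+ 4 + (1 - p) * p ^+ 4 <= 1.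
  have : (1 - p) ^+ 4 <= 1 by exact: exprn_ile1.
  have : p ^+ 4 <= 1 by exact: exprn_ile1.
  by move: ((1 - p) ^+ 4) (p ^+ 4) => u v ? ?; nra.
have h2 : (p * (1 - p) ^+ 2 + (1 - p) * p ^+ 2) * (p * (1 - p)) <= 1.
  have : p * (1 - p) <= 1 by nra.
  have : 0 <= p * (1 - p) by exact: mulr_ge0.
  rewrite (_ : p * (1 - p) ^+ 2 + (1 - p) * p ^+ 2 = p * (1 - p)); last by ring.
  by move: (p * (1 - p)) => w ? ?; nra.
have {}h2 := ler_wpM2r (mulr_ge0 c0 V0) h2.
have {}h1 := ler_wpM2r (sqr_ge0 (c i ^+ 2)) h1.
move: h1 h2 IH; rewrite (_ : c i ^+ 4 = (c i ^+ 2) ^+ 2); last by ring.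
move: (c i ^+ 2) (V s) => u v h1 h2 IH.
have := sqr_ge0 u; lra.
Qed.

End LinearStatistic.
End BernoulliVector.

Section MeanStatistics.
Context {R : realType} {p : R} {N : nat}.
Hypotheses (p01 : 0 <= p <= 1) (N0 : (0 < N)%N).
Variable c : 'I_N -> R.
Let score (f : {ffun 'I_N -> bool}) := mean (fun i => c i * ((f i)%:R - p)).
Let Nn0 : N%:R != 0 :> R. Proof. by rewrite pnatr_eq0 -lt0n. Qed.

Lemma Ex_mean : Ex p score = 0.
Proof.
transitivity (N%:R^-1 * 0 : R); last by rewrite mulr0.
rewrite -(Ex_linear p c (index_enum_uniq 'I_N)) -ExZ.
by apply: eq_Ex => f; rewrite /score /mean mulrC.
Qed.

Lemma Ex_mean2 : Ex p (fun f => score f ^+ 2)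
  = p * (1 - p) * mean (fun i => c i ^+ 2) / N%:R.
Proof.
transitivity (N%:R ^- 2 * (p * (1 - p) * \sum_i c i ^+ 2) : R).
  rewrite -(Ex_linear2 p c (index_enum_uniq 'I_N)) -ExZ.
  by apply: eq_Ex => f; rewrite /score /mean exprMn exprVn mulrC.
by rewrite /mean; field.
Qed.

(** The bound involves only the second moment of the coefficients, hence only the
    fourth moment of the covariates when the coefficients are quadratic in them. *)
Lemma Ex_mean4 : Ex p (fun f => score f ^+ 4)
  <= 3 * mean (fun i => c i ^+ 2) ^+ 2 / N%:R ^+ 2.
Proof.
have -> : Ex p (fun f => score f ^+ 4)
   = N%:R ^- 4 * Ex p (fun f => (\sum_i c i * ((f i)%:R - p)) ^+ 4).
  by rewrite -ExZ; apply: eq_Ex => f; rewrite /score /mean exprMn exprVn mulrC.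
have N4 : 0 <= N%:R ^- 4 :> R by rewrite invr_ge0 exprn_ge0.
apply: (le_trans (ler_wpM2l N4 (Ex_linear4 p01 c (index_enum_uniq 'I_N)))).
by rewrite le_eqVlt; apply/orP; left; apply/eqP; rewrite /mean; field.
Qed.

End MeanStatistics.

Section VarianceComparison.
Context {R : realType} {p : R} {I : finType}.
Hypothesis p01 : 0 <= p <= 1.
Implicit Types F L : {ffun I -> bool} -> R.

(** If [F] is close in mean square to the centred statistic [L], their variances
    are close.  The weighted inequality [2 * x * y <= theta * x ^+ 2 + y ^+ 2 / theta]
    replaces the square root that Cauchy-Schwarz would bring. *)
Lemma variance_comparison F L (theta : R) : 0 < theta -> Ex p L = 0 ->
  `| Ex p (fun f => (F f - Ex p F) ^+ 2) - Ex p (fun f => L f ^+ 2) |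
  <= theta * Ex p (fun f => L f ^+ 2)
     + (1 + theta^-1) * Ex p (fun f => (F f - L f) ^+ 2).
Proof.
move=> th0 EL.
pose e f := F f - Ex p F - L f.
have Ee : Ex p (fun f => e f ^+ 2) <= Ex p (fun f => (F f - L f) ^+ 2).
  have EFL : Ex p (fun f => F f - L f) = Ex p F.
    rewrite (_ : (fun f => _) = fun f => F f + (- 1) * L f); last by apply/funext => f; ring.
    by rewrite ExD ExZ EL mulr0 addr0.
  have -> : Ex p (fun f => e f ^+ 2) = Ex p (fun f => (F f - L f) ^+ 2) - Ex p F ^+ 2.
    rewrite (@eq_Ex _ _ _ (fun f => e f ^+ 2) (fun f => (F f - L f) ^+ 2 + ((- 2 * Ex p F) * (F f - L f) + Ex p F ^+ 2))) => [|f]; last first.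
      by rewrite /e; ring.
    by rewrite !ExD ExZ Ex_cst// EFL; ring.
  by rewrite lerBlDr lerDl sqr_ge0.
have ti : 0 < theta^-1 by rewrite invr_gt0.
have tti : theta * theta^-1 = 1 by rewrite mulfV// gt_eqF.
have cross f : 2 * `|L f * e f| <= theta * L f ^+ 2 + theta^-1 * e f ^+ 2.
  have : 0 <= theta^-1 * (theta * `|L f| - `|e f|) ^+ 2 by rewrite mulr_ge0 ?sqr_ge0// ltW.
  rewrite (_ : theta^-1 * _ = (theta * theta^-1) * theta * `|L f| ^+ 2 - 2 * (theta * theta^-1) * (`|L f| * `|e f|) + theta^-1 * `|e f| ^+ 2); last by ring.
  by rewrite tti normrM !real_normK ?num_real//; lra.
have E0 : 0 <= Ex p (fun f => e f ^+ 2) by apply: (Ex_ge0 p01) => f; exact: sqr_ge0.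
have upper : Ex p (fun f => (F f - Ex p F) ^+ 2) <=
   (1 + theta) * Ex p (fun f => L f ^+ 2) + (1 + theta^-1) * Ex p (fun f => e f ^+ 2).
  rewrite -!ExZ -ExD; apply: (le_Ex p01) => f.
  have := cross f; have := ler_norm (L f * e f); rewrite /e; lra.
have lower : (1 - theta) * Ex p (fun f => L f ^+ 2) + (- theta^-1) * Ex p (fun f => e f ^+ 2)
   <= Ex p (fun f => (F f - Ex p F) ^+ 2).
  rewrite -!ExZ -ExD; apply: (le_Ex p01) => f.
  have := cross f; have := ler_norm (- (L f * e f)); rewrite normrN.
  have := sqr_ge0 (e f); rewrite /e; lra.
have t1 : 0 <= 1 + theta^-1 by lra.
have := ler_wpM2l t1 Ee; rewrite ler_norml => hE; apply/andP; split; lra.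
Qed.

End VarianceComparison.

(** * Reduction of the error variance to a finite sum *)

Section TreatmentLaw.
Context {R : realType} {p mu : R} {N : nat}.
Hypothesis p01 : 0 <= p <= 1.
Variable E : trial p mu N.
Local Notation P := (treat_prob E).

Definition assignment (w : treat_space E) : {ffun 'I_N -> bool} :=
  [ffun i => treat E i w].

Let event (f : {ffun 'I_N -> bool}) := [set w | assignment w = f].

Let eventE f : event f = \bigcap_(i in [set` finset.setTfor 'I_N]) (treat E i : treat_space E -> bool) @^-1` [set f i].
Proof.
apply/seteqP; split => w /=.
  by move=> <- i _ /=; rewrite ffunE.
by move=> h; apply/ffunP => i; rewrite ffunE; apply: h; rewrite /= inE.
Qed.

Let measurable_event f : measurable (event f).
Proof.
rewrite eventE; apply: fin_bigcap_measurable => //.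
by move=> i _; rewrite -[X in measurable X]setTI; exact: measurable_funP.
Qed.

(** Mutual independence, used for the full set of units, gives the product law. *)
Lemma assignment_prob f :
  P [set w | assignment w = f] = (bernoulli_weight p f)%:E.
Proof.
rewrite -/(event f) eventE (@treat_indep _ _ _ _ E (finset.setTfor 'I_N) (fun i => [set f i]))//.
rewrite /bernoulli_weight [LHS](eq_bigl xpredT) => [|i]; last by rewrite finset.in_setT.
rewrite -prodEFin; apply: eq_bigr => i _.
have := treat_bernoulli E i => /(congr1 (fun m => m [set f i])) /=.
by rewrite /bernoulli_prob p01 fsbig_set1.
Qed.

(** A statistic of the assignment is a simple function. *)
Lemma expectation_assignment (G : {ffun 'I_N -> bool} -> R) :
  ('E_P[fun w => G (assignment w)] = (Ex p G)%:E)%E.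
Proof.
rewrite unlock.
have -> : (fun w => (G (assignment w))%:E) =
  (fun w => \sum_f (G f)%:E * (\1_(event f) w)%:E)%E.
  apply/funext => w; rewrite (bigD1 (assignment w))//= indicE mem_set//= mule1.
  rewrite big1 ?adde0// => f fw; rewrite indicE memNset ?mule0//=.
  by move=> wf; rewrite wf eqxx in fw.
have int_event f : P.-integrable setT (EFin \o (\1_(event f) : treat_space E -> R)).
  exact: integrable_indic.
rewrite integral_sum//; last by move=> f; apply: integrableZl => //; exact: int_event.
rewrite /Ex -sumEFin; apply: eq_bigr => f _.
rewrite integralZl//; last exact: int_event.
rewrite integral_indic// setIT [in RHS]mulrC EFinM; congr (_ * _)%E.
exact: assignment_prob.
Qed.

Lemma variance_assignment (G : {ffun 'I_N -> bool} -> R) :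
  variance P (fun w => G (assignment w))
  = (Ex p (fun f => (G f - Ex p G) ^+ 2))%:E.
Proof.
rewrite /variance unlock expectation_assignment /= -expectation_assignment.
by congr expectation.
Qed.

Lemma noise_expectation (a : 'I_N -> R) (c : R) :
  ('E_(noise_prob E)[fun w => (\sum_i a i * noise E i w + c)%R] = c%:E)%E.
Proof.
rewrite unlock.
have int_noise i : (noise_prob E).-integrable setT (fun w => (a i)%:E * (noise E i w)%:E)%E.
  by apply: integrableZl => //; exact: noise_integrable.
under eq_integral do rewrite EFinD -sumEFin.
rewrite integralD//=.
- rewrite integral_sum//=.
  rewrite big1 ?add0e.
    have := expectation_cst (noise_prob E) c; rewrite unlock; exact.
  move=> i _; under eq_integral do rewrite EFinM.
  rewrite integralZl//; last exact: noise_integrable.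
  by have := noise_centered E i; rewrite unlock => ->; rewrite mule0.
- by apply: integrable_sum => // i _; exact: int_noise.
- exact: finite_measure_integrable_cst.
Qed.

End TreatmentLaw.

Section ErrorVariance.
Context {R : realType}.
Variables (gamma fc p mu : R) (N : nat) (E : trial p mu N).
Hypothesis p01 : 0 <= p <= 1.

(** The error once the noise has been averaged out. *)
Definition noiseless_error (m : method) (f : {ffun 'I_N -> bool}) : R :=
  estimate gamma fc p (cov E) m f (fun=> 0) - average_effect gamma (cov E).

Lemma error_varianceE m : error_variance E gamma fc m =
  (Ex p (fun f => (noiseless_error m f - Ex p (noiseless_error m)) ^+ 2))%:E.
Proof.
rewrite -(variance_assignment p01 E) /error_variance /treatment_variance.
congr variance; apply/funext => w.
have [a aE] := estimate_noise gamma fc p (cov E) (assignment (E := E) w) m.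
have -> : (fun i => treat E i w) = assignment w :> ('I_N -> bool).
  by apply/funext => i; rewrite ffunE.
rewrite (_ : (fun w' => _) = fun w' => \sum_i a i * noise E i w' + noiseless_error m (assignment w)).
  by rewrite noise_expectation.
by apply/funext => w'; rewrite aE /noiseless_error addrA.
Qed.

End ErrorVariance.

(** * The delta method as a pointwise inequality *)

Section DeltaMethod.
Context {R : realType}.
Implicit Types a b h q n p mu gamma : R.

(** If [B] is within [D / 2] of [D], then [S = (a + Rm) / B] is compared directly
    with [a / D].  Otherwise [(B - D) ^+ 4] is at least [D ^+ 4 / 16], and the
    crude bound [S ^+ 2 <= M] is paid for by this factor.  When [B = 0] the value
    of [S] is only required to satisfy the crude bound. *)
Lemma ratio_linearization (S a Rm B D M : R) : 0 < D -> S ^+ 2 <= M ->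
  (B != 0 -> S * B = a + Rm) ->
  (S - a / D) ^+ 2 * D ^+ 4
  <= 8 * Rm ^+ 2 * D ^+ 2 + 4 * a ^+ 4 + (4 + 32 * M) * (B - D) ^+ 4.
Proof.
move=> D0 SM SB; set d := B - D; set X := S - a / D.
have aE : a = (S - X) * D by rewrite /X opprB addrCA subrr addr0 divfK// gt_eqF.
have amgm : 2 * (a ^+ 2 * d ^+ 2) <= a ^+ 4 + d ^+ 4.
  by have := sqr_ge0 (a ^+ 2 - d ^+ 2); rewrite sqrrB -!exprM; lra.
have M0 : 0 <= M by exact: le_trans (sqr_ge0 S) SM.
have d4 : 0 <= d ^+ 4 by rewrite exprn_even_ge0.
have a4 : 0 <= a ^+ 4 by rewrite exprn_even_ge0.
have R2 : 0 <= Rm ^+ 2 * D ^+ 2 by rewrite mulr_ge0 ?sqr_ge0.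
have [small|large] := leP (4 * d ^+ 2) (D ^+ 2).
  have B2 : D ^+ 2 <= 4 * B ^+ 2.
    have : - D <= 2 * d.
      rewrite leNgt; apply/negP => dD; have {}dD : 0 < - D - 2 * d by lra.
      have Dd : 0 < D - 2 * d by lra.
      by have := mulr_gt0 dD Dd; lra.
    rewrite /d => hB; have {}hB : D <= 2 * B by lra.
    by have := ler_pM (ltW D0) (ltW D0) hB hB; lra.
  have Bn0 : B != 0.
    by apply: contraTN B2 => /eqP ->; rewrite expr0n mulr0 -ltNge exprn_gt0.
  have XB : X * B * D = Rm * D - a * d.
    have := SB Bn0; rewrite /X /d => e.
    have -> : (S - a / D) * B * D = S * B * D - a * B by field; rewrite gt_eqF.
    by rewrite e; ring.
  have key : (X * B * D) ^+ 2 <= 2 * (Rm * D) ^+ 2 + 2 * (a * d) ^+ 2.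
    rewrite XB; have := sqr_ge0 (Rm * D + a * d); lra.
  have : X ^+ 2 * D ^+ 2 * D ^+ 2 <= X ^+ 2 * D ^+ 2 * (4 * B ^+ 2).
    by apply: ler_wpM2l B2; rewrite mulr_ge0// sqr_ge0.
  have Md : 0 <= M * d ^+ 4 by exact: mulr_ge0.
  move: key; rewrite !exprMn (_ : D ^+ 4 = D ^+ 2 * D ^+ 2); last by rewrite -exprD.
  lra.
have X2 : X ^+ 2 * D ^+ 4 <= 2 * M * D ^+ 4 + 2 * (a ^+ 2 * D ^+ 2).
  have : X ^+ 2 <= 2 * S ^+ 2 + 2 * (a / D) ^+ 2.
    by rewrite /X; have := sqr_ge0 (S + a / D); lra.
  move=> hX; have D4 : 0 <= D ^+ 4 by rewrite exprn_ge0// ltW.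
  apply: le_trans (ler_wpM2r D4 hX) _.
  have -> : (2 * S ^+ 2 + 2 * (a / D) ^+ 2) * D ^+ 4
     = 2 * (S ^+ 2 * D ^+ 4) + 2 * (a ^+ 2 * D ^+ 2) by field; rewrite gt_eqF.
  by have := ler_wpM2r D4 SM; lra.
have Dd : D ^+ 4 <= 16 * d ^+ 4.
  have := ler_pM (sqr_ge0 D) (sqr_ge0 D) (ltW large) (ltW large); lra.
have := ler_wpM2l M0 Dd; have := ler_wpM2l (sqr_ge0 a) (ltW large).
lra.
Qed.

(** [U] stands for the sum of the squared scores: [a] and [B - D] are of first
    order in the scores and [Rm] of second order. *)
Lemma ratio_linearization_quadratic (S a Rm B D M C U : R) :
  0 < D -> 0 <= U -> S ^+ 2 <= M -> (B != 0 -> S * B = a + Rm) ->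
  a ^+ 2 <= C * U -> Rm ^+ 2 <= C ^+ 2 * U ^+ 2 -> (B - D) ^+ 2 <= C * U ->
  (S - a / D) ^+ 2 <= (8 * C ^+ 2 * D ^+ 2 + 40 * C ^+ 2) / D ^+ 4 * (1 + M) * U ^+ 2.
Proof.
move=> D0 U0 SM SB aU RU dU.
have M0 : 0 <= M by exact: le_trans (sqr_ge0 S) SM.
have D4 : 0 < D ^+ 4 by rewrite exprn_gt0.
rewrite -(ler_pM2r D4); apply: le_trans (ratio_linearization D0 SM SB) _.
rewrite [leRHS](_ : _ = (8 * C ^+ 2 * D ^+ 2 + 40 * C ^+ 2) * (1 + M) * U ^+ 2); last first.
  by field; rewrite gt_eqF.
have sq4 (u : R) : u ^+ 2 <= C * U -> u ^+ 4 <= C ^+ 2 * U ^+ 2.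
  move=> uU; rewrite -exprMn (_ : u ^+ 4 = (u ^+ 2) ^+ 2); last by rewrite -exprM.
  by apply: lerXn2r => //; rewrite nnegrE ?sqr_ge0// (le_trans _ uU)// sqr_ge0.
have {}aU := sq4 _ aU; have {}dU := sq4 _ dU.
have D2 := sqr_ge0 D.
have {}RU := ler_wpM2r D2 RU.
have CU0 : 0 <= C ^+ 2 * U ^+ 2 by rewrite -exprMn sqr_ge0.
have M1 : 0 <= 4 + 32 * M by lra.
have {}dU := ler_wpM2l M1 dU.
have h1 : 0 <= M * (C ^+ 2 * U ^+ 2) by exact: mulr_ge0.
have h2 : 0 <= M * (C ^+ 2 * U ^+ 2 * D ^+ 2) by apply: mulr_ge0 => //; exact: mulr_ge0.
move: CU0 aU dU RU h1 h2; set c := C ^+ 2 * U ^+ 2 => CU0 aU dU RU h1 h2.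
rewrite [leRHS](_ : _ = 8 * (c * D ^+ 2) + 8 * (M * (c * D ^+ 2)) + 40 * c + 40 * (M * c)).
  by lra.
by rewrite /c; ring.
Qed.

End DeltaMethod.

(** One constant large enough, for the three methods, to bound the numerator, its
    remainder and the drift of the denominator by powers of the scores. *)
Definition drift_bound (R : realType) (gamma mu : R) : R :=
  32 * (1 + gamma ^+ 2) * (1 + mu ^+ 2) ^+ 2.

Section MethodDelta.
Context {R : realType}.
Variables (gamma mu p q b h : R).
Hypotheses (p0 : 0 < p) (p1 : p < 1) (q1 : q ^+ 2 <= 1) (b1 : b ^+ 2 <= 1).

Local Notation C := (drift_bound gamma mu).
Local Notation U := (q ^+ 2 + b ^+ 2 + h ^+ 2).

(** The constant of [ratio_linearization_quadratic] for the limit denominator [D]. *)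
Definition delta_constant (D : R) : R :=
  (8 * C ^+ 2 * D ^+ 2 + 40 * C ^+ 2) / D ^+ 4.


Let U0 : 0 <= U. Proof. by rewrite !addr_ge0 ?sqr_ge0. Qed.

Let pp0 : 0 < p * (1 - p). Proof. by rewrite mulr_gt0 ?subr_gt0. Qed.

Let s1 : 1 <= (1 + mu ^+ 2) ^+ 2. Proof. nra. Qed.

Let CE : 32 * (1 + gamma ^+ 2) <= C.
Proof. by rewrite /drift_bound ler_peMr// mulr_ge0// addr_ge0// sqr_ge0. Qed.

Let le_CU (k v w : R) : 0 <= w -> k <= C -> v <= k * w -> w <= U -> v <= C * U.
Proof.
have g2 := sqr_ge0 gamma; move=> w0 kC vw wU; apply: (le_trans vw).
have C0 : 0 <= C by move: CE g2; lra.
by apply: (le_trans (ler_wpM2r w0 kC)); exact: ler_wpM2l.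
Qed.

Let q12p : (1 - 2 * p) ^+ 2 <= 1.
Proof. by have := pp0; nra. Qed.

(** Here the remainder of the numerator is [- (gamma * q * b)]. *)
Lemma slr_linearization (S M : R) : S ^+ 2 <= M ->
  ((p + q) * (1 - p - q) != 0 -> S * ((p + q) * (1 - p - q)) = gamma * (1 - p - q) * b) ->
  (S - gamma * (1 - p) * b / (p * (1 - p))) ^+ 2
  <= delta_constant (p * (1 - p)) * (1 + M) * U ^+ 2.
Proof.
have q2 := sqr_ge0 q; have b2 := sqr_ge0 b; have h2 := sqr_ge0 h.
have p0' := p0; have p1' := p1; have q1' := q1; have b1' := b1.
have g2 := sqr_ge0 gamma; have m2 := sqr_ge0 mu; have cE := CE; have ppE := pp0; have uE := U0.
move=> SM SB.
apply: (@ratio_linearization_quadratic _ S _ (- (gamma * q * b)) ((p + q) * (1 - p - q))) => //.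
- by move=> /SB ->; ring.
- apply: (le_CU (k := gamma ^+ 2) b2); [lra| |lra].
  rewrite !exprMn -mulrA ler_wpM2l// ler_piMl// -[leRHS]mul1r.
  have : 0 <= 1 - p <= 1 by apply/andP; split; lra.
  move: (1 - p) => r /andP[r0 r1]; nra.
- have gC : gamma ^+ 2 <= C ^+ 2.
    have : 0 <= 1 + gamma ^+ 2 by lra. have : 1 + gamma ^+ 2 <= C by lra. nra.
  rewrite sqrrN (_ : (gamma * q * b) ^+ 2 = gamma ^+ 2 * (q ^+ 2 * b ^+ 2)); last by ring.
  have bqU : q ^+ 2 * b ^+ 2 <= U ^+ 2 by nra.
  apply: (le_trans (ler_wpM2l g2 bqU)); apply: ler_wpM2r gC; exact: sqr_ge0.
- apply: (le_CU (k := 4) q2); [lra| |lra].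
  have -> : (p + q) * (1 - p - q) - p * (1 - p) = (1 - 2 * p) * q - q * q by ring.
  have : ((1 - 2 * p) * q) ^+ 2 <= q ^+ 2 by rewrite exprMn ler_piMl.
  have : (q * q) ^+ 2 <= q ^+ 2 by rewrite exprMn ler_piMl.
  have := sqr_ge0 ((1 - 2 * p) * q + q * q); lra.
Qed.

(** Here the remainder of the numerator is [- (gamma * b * (q + h))]. *)
Lemma mlr_linearization (S M : R) :
  let B := (p + q) * (1 - p - q) - b ^+ 2 in
  S ^+ 2 <= M -> (B != 0 -> S * B = gamma * b * (1 - 2 * p - q - h)) ->
  (S - gamma * (1 - 2 * p) * b / (p * (1 - p))) ^+ 2
  <= delta_constant (p * (1 - p)) * (1 + M) * U ^+ 2.
Proof.
have q2 := sqr_ge0 q; have b2 := sqr_ge0 b; have h2 := sqr_ge0 h.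
have p0' := p0; have p1' := p1; have q1' := q1; have b1' := b1.
have g2 := sqr_ge0 gamma; have m2 := sqr_ge0 mu; have cE := CE; have ppE := pp0; have uE := U0.
move=> B SM SB.
apply: (@ratio_linearization_quadratic _ S _ (- (gamma * (b * (q + h)))) B) => //.
- by move=> /SB ->; ring.
- apply: (le_CU (k := gamma ^+ 2) b2); [lra| |lra].
  by rewrite !exprMn -mulrA ler_wpM2l// ler_piMl.
- have gC : 2 * gamma ^+ 2 <= C ^+ 2.
    have : 0 <= 1 + gamma ^+ 2 by lra. have : 2 * (1 + gamma ^+ 2) <= C by lra. nra.
  have bqU : (b * (q + h)) ^+ 2 <= 2 * U ^+ 2.
    have e : (q + h) ^+ 2 <= 2 * U by have := sqr_ge0 (q - h); lra.
    have e' : b ^+ 2 <= U by lra.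
    by rewrite exprMn; have := ler_pM b2 (sqr_ge0 _) e' e; lra.
  rewrite sqrrN exprMn.
  apply: (le_trans (ler_wpM2l g2 bqU)).
  by have := ler_wpM2r (sqr_ge0 U) gC; lra.
- apply: (le_CU (k := 6) (w := q ^+ 2 + b ^+ 2)); [lra|lra| |lra].
  have -> : B - p * (1 - p) = (1 - 2 * p) * q - q * q - b * b by rewrite /B; ring.
  have : ((1 - 2 * p) * q) ^+ 2 <= q ^+ 2 by rewrite exprMn ler_piMl.
  have : (q * q) ^+ 2 <= q ^+ 2 by rewrite exprMn ler_piMl.
  have : (b * b) ^+ 2 <= b ^+ 2 by rewrite exprMn ler_piMl.
  move: ((1 - 2 * p) * q) (q * q) (b * b) => u v w.
  have := sqr_ge0 (u + v); have := sqr_ge0 (u + w); have := sqr_ge0 (v - w); lra.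
Qed.

(** Here the numerator is linear in the scores; only the denominator drifts. *)
Lemma mcm_linearization (S M : R) :
  let D := p * (1 - p) * (1 + mu ^+ 2) in
  let B := D + (1 - 2 * p) * (h + 2 * mu * b + mu ^+ 2 * q) - (b + mu * q) ^+ 2 in
  S ^+ 2 <= M -> (B != 0 -> S * B = gamma * mu * p * (h + mu * b)) ->
  (S - gamma * mu * p * (h + mu * b) / D) ^+ 2
  <= delta_constant D * (1 + M) * U ^+ 2.
Proof.
have q2 := sqr_ge0 q; have b2 := sqr_ge0 b; have h2 := sqr_ge0 h.
have p0' := p0; have p1' := p1; have q1' := q1; have b1' := b1.
have g2 := sqr_ge0 gamma; have m2 := sqr_ge0 mu; have cE := CE; have ppE := pp0; have uE := U0.
move=> D B SM SB.
have sE := s1; set s := 1 + mu ^+ 2 in sE *.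
have s2 : 1 <= s by rewrite /s lerDl.
have D0 : 0 < D by rewrite mulr_gt0// (lt_le_trans ltr01).
have CS : 32 * s ^+ 2 <= C.
  by rewrite /drift_bound -/s -mulrA ler_wpM2l// ler_peMl ?sqr_ge0// lerDl.
apply: (@ratio_linearization_quadratic _ S _ 0 B) => //.
- by move=> /SB ->; rewrite addr0.
- have m4 : mu ^+ 2 * s <= s ^+ 2 by rewrite /s; nra.
  apply: (le_CU (k := 2 * gamma ^+ 2 * s ^+ 2) U0) => //.
    rewrite /drift_bound -/s; have := mulr_ge0 g2 (sqr_ge0 s); have := sqr_ge0 s; lra.
  have e : (h + mu * b) ^+ 2 <= 2 * s * U.
    have : 0 <= (1 + mu ^+ 2) * q ^+ 2 by rewrite mulr_ge0// addr_ge0.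
    have : 0 <= mu ^+ 2 * h ^+ 2 by rewrite mulr_ge0.
    have := sqr_ge0 (h - mu * b); rewrite /s; lra.
  have pp : p ^+ 2 <= 1 by rewrite exprn_ile1// ltW.
  rewrite 3!exprMn.
  have e1 : gamma ^+ 2 * mu ^+ 2 * p ^+ 2 <= gamma ^+ 2 * mu ^+ 2.
    by rewrite ler_piMr// mulr_ge0.
  have gm := mulr_ge0 g2 m2.
  apply: le_trans (ler_pM _ (sqr_ge0 _) e1 e) _.
    by rewrite mulr_ge0// sqr_ge0.
  by have := ler_wpM2r U0 (ler_wpM2l g2 m4); lra.
- by rewrite expr0n /= mulr_ge0 ?sqr_ge0.
- apply: (le_CU (k := 32 * s ^+ 2) U0) => //.
  set w1 := b + mu * q; set w2 := h + 2 * mu * b + mu ^+ 2 * q.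
  have -> : B - D = (1 - 2 * p) * w2 - w1 ^+ 2 by rewrite /B -/w1 -/w2; ring.
  have ss : s <= s ^+ 2 by rewrite expr2 ler_peMl// (le_trans ler01).
  have mq : mu ^+ 2 <= s ^+ 2 by rewrite /s in ss *; lra.
  have mm : (mu ^+ 2) ^+ 2 <= s ^+ 2.
    by apply: lerXn2r; rewrite ?nnegrE// /s ?lerDr// addr_ge0.
  have w2U : w2 ^+ 2 <= 12 * s ^+ 2 * U.
    have e1 := ler_wpM2r h2 sE; have e2 := ler_wpM2r b2 mq; have e3 := ler_wpM2r q2 mm.
    have e4 : 0 <= s ^+ 2 * q ^+ 2 by rewrite mulr_ge0// sqr_ge0.
    have e5 : 0 <= s ^+ 2 * h ^+ 2 by rewrite mulr_ge0// sqr_ge0.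
    have : w2 ^+ 2 <= 3 * (h ^+ 2 + (2 * mu * b) ^+ 2 + (mu ^+ 2 * q) ^+ 2).
      rewrite /w2; move: (2 * mu * b) (mu ^+ 2 * q) => u v.
      have := sqr_ge0 (h - u); have := sqr_ge0 (h - v); have := sqr_ge0 (u - v); lra.
    by lra.
  have w1U : w1 ^+ 2 <= 2 * s * U.
    have : 0 <= (1 + mu ^+ 2) * h ^+ 2 by rewrite mulr_ge0// addr_ge0.
    have : 0 <= mu ^+ 2 * b ^+ 2 by rewrite mulr_ge0.
    have := sqr_ge0 (b - mu * q); rewrite /w1 /s; lra.
  have w11 : w1 ^+ 2 <= 2 * s.
    have := ler_wpM2l m2 q1.
    have := sqr_ge0 (b - mu * q); rewrite /w1 /s; move: b1; lra.
  have w4 : (w1 ^+ 2) ^+ 2 <= 4 * s ^+ 2 * U.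
    by have := ler_pM (sqr_ge0 w1) (sqr_ge0 w1) w11 w1U; lra.
  have : ((1 - 2 * p) * w2) ^+ 2 <= w2 ^+ 2 by rewrite exprMn ler_piMl// sqr_ge0.
  have := sqr_ge0 ((1 - 2 * p) * w2 + w1 ^+ 2).
  by move: ((1 - 2 * p) * w2) (w1 ^+ 2) w2U w4 => u v; lra.
Qed.

End MethodDelta.

(** * Error bounds for the three estimators *)

Section Covariates.
Context {R : realType} {p mu : R} {N : nat}.
Variable E : trial p mu N.
Hypothesis N0 : (0 < N)%N.
Let z i := cov E i - mu.

Lemma cov_moment2 : mean (fun i => (cov E i - mu) ^+ 2) = 1.
Proof. by have := cov_moments E (isT : 2 <= 4)%N; rewrite gaussian_moment2 => -[]. Qed.

Lemma cov_moment3 : mean (fun i => (cov E i - mu) ^+ 3) = 0.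
Proof. by have := cov_moments E (isT : 3 <= 4)%N; rewrite gaussian_moment3 => -[]. Qed.

Lemma cov_moment4 : mean (fun i => (cov E i - mu) ^+ 4) = 3.
Proof. by have := cov_moments E (isT : 4 <= 4)%N; rewrite gaussian_moment4 => -[]. Qed.

Lemma cov_centered : mean (fun i => cov E i - mu) = 0.
Proof. by rewrite meanD mean_cst// cov_mean subrr. Qed.

(** One fourth power is at most the sum of all of them, [3 * N]. *)
Lemma cov_deviation_le i : (cov E i - mu) ^+ 2 <= 2 * Num.sqrt N%:R.
Proof.
have := @le_sum_mean _ _ (fun i => (cov E i - mu) ^+ 4) i.
rewrite cov_moment4 => /(_ (fun j => _)) h.
have {}h : ((cov E i - mu) ^+ 2) ^+ 2 <= N%:R * 3.
  by rewrite -exprM; apply: h => j; rewrite exprn_even_ge0.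
rewrite -(@ler_pXn2r _ 2)// ?nnegrE ?sqr_ge0 ?mulr_ge0 ?sqrtr_ge0//.
rewrite [leRHS]exprMn sqr_sqrtr//; apply: le_trans h _.
have := ler0n R N; lra.
Qed.

Lemma cov_sq_le i : cov E i ^+ 2 <= (4 + 2 * mu ^+ 2) * Num.sqrt N%:R.
Proof.
have := cov_deviation_le i; have : 1 <= Num.sqrt N%:R :> R.
  by rewrite -[leLHS]sqrtr1 ler_sqrt// ler1n.
move: (Num.sqrt _) => r r1 h; have := sqr_ge0 (cov E i - 2 * mu).
have := ler_wpM2l (sqr_ge0 mu) r1; lra.
Qed.

(** A quadratic polynomial of the covariates cannot be small on average: on
    [1, z, z ^+ 2] the normal moments define a quadratic form equal to
    [2 * a ^+ 2] plus two squares.  In particular the covariates take more than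
    two values. *)
Lemma mean_square_quadratic (a b c : R) :
  2 * a ^+ 2 <= mean (fun i => (a * cov E i ^+ 2 + b * cov E i + c) ^+ 2).
Proof.
pose b' := 2 * a * mu + b; pose c' := a * mu ^+ 2 + b * mu + c.
rewrite (@eq_mean _ _ _ (fun i => a ^+ 2 * z i ^+ 4 + (2 * a * b' * z i ^+ 3 +
  ((b' ^+ 2 + 2 * a * c') * z i ^+ 2 + (2 * b' * c' * z i + c' ^+ 2))))) => [|i]; last first.
  by rewrite /z /b' /c'; ring.
rewrite !meanD !meanZ mean_cst// /z cov_moment2 cov_moment3 cov_moment4 cov_centered.
have := sqr_ge0 (a + c'); have := sqr_ge0 b'; lra.
Qed.

End Covariates.

Section MethodErrors.
Context {R : realType}.
Variables (gamma fc p mu : R) (N : nat) (E : trial p mu N).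
Hypotheses (p0 : 0 < p) (p1 : p < 1) (N0 : (0 < N)%N).
Variable f : {ffun 'I_N -> bool}.
Let x := cov E.
Let z i := x i - mu.
Let tau i : R := (f i)%:R - p.
Let q := mean tau.
Let b := mean (fun i => tau i * z i).
Let h := mean (fun i => tau i * z i ^+ 2).
Let Z : R := 2 * Num.sqrt N%:R.

Let z1 : mean z = 0. Proof. exact: cov_centered. Qed.
Let z2 : mean (fun i => z i ^+ 2) = 1. Proof. exact: cov_moment2. Qed.

Let tau_sq i : tau i ^+ 2 <= 1.
Proof. by have := p0; have := p1; rewrite /tau; case: (f i) => /= ? ?; nra. Qed.

Lemma treatment_score_le1 : q ^+ 2 <= 1.
Proof.
apply: le_trans (sqr_mean_le _ N0) _; rewrite -[leRHS](mean_cst 1 N0).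
exact: le_mean.
Qed.

Lemma covariate_score_le1 : b ^+ 2 <= 1.
Proof.
apply: le_trans (sqr_mean_le _ N0) _; rewrite -[leRHS]z2.
by apply: le_mean => i; rewrite exprMn ler_piMl// sqr_ge0.
Qed.

(* [n] is the fraction of treated units, [H] the part of the second moment of *)
(* the covariates that they carry, and [b] the part of the first moment. *)
Let n := p + q.
Let H := h + p.

Let nE : n = mean (fun i => (f i)%:R).
Proof.
rewrite (@eq_mean _ _ (fun i => (f i)%:R) (fun i => tau i + p)) => [|i].
  by rewrite meanD mean_cst// addrC.
by rewrite /tau subrK.
Qed.

Let HE : H = mean (fun i => (f i)%:R * z i ^+ 2).
Proof.
rewrite (@eq_mean _ _ (fun i => _ * _) (fun i => tau i * z i ^+ 2 + p * z i ^+ 2)) => [|i].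
  by rewrite meanD meanZ z2 mulr1.
by rewrite /tau; ring.
Qed.

Let bE : b = mean (fun i => (f i)%:R * z i).
Proof.
rewrite (@eq_mean _ _ (fun i => _ * z i) (fun i => tau i * z i + p * z i)) => [|i].
  by rewrite meanD meanZ z1 mulr0 addr0.
by rewrite /tau; ring.
Qed.

Let n1E : 1 - n = mean (fun i => 1 - (f i)%:R).
Proof.
rewrite nE (@eq_mean _ _ (fun i => 1 - _) (fun i => 1 + (- 1) * (f i)%:R)) => [|i].
  by rewrite meanD meanZ mean_cst// mulN1r.
by ring.
Qed.

Let H1E : 1 - H = mean (fun i => (1 - (f i)%:R) * z i ^+ 2).
Proof.
rewrite HE (@eq_mean _ _ (fun i => (1 - _) * _) (fun i => z i ^+ 2 + (- 1) * ((f i)%:R * z i ^+ 2))) => [|i].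
  by rewrite meanD meanZ z2 mulN1r.
by ring.
Qed.

Let n_ge0 : 0 <= n.
Proof. by rewrite nE; apply: mean_ge0. Qed.

Let n_le1 : 0 <= 1 - n.
Proof. by rewrite n1E; apply: mean_ge0 => i; case: (f i) => /=; rewrite subr_ge0. Qed.

(* The dispersion of the covariates within the treated group is nonnegative; *)
(* likewise for the untreated group in the next lemma. *)
Let treated_spread : b ^+ 2 <= n * H.
Proof.
have := mean_cauchy_schwarz (fun i => (f i)%:R) (fun i => (f i)%:R * z i).
rewrite (@eq_mean _ _ (fun i => (f i)%:R * _) (fun i => (f i)%:R * z i)) => [|i]; last first.
  by case: (f i); rewrite ?mul1r ?mul0r.
rewrite (@eq_mean _ _ (fun i => (f i)%:R ^+ 2) (fun i => (f i)%:R)) => [|i]; last first.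
  by case: (f i); rewrite ?expr1n ?expr0n.
rewrite (@eq_mean _ _ (fun i => (_ * _) ^+ 2) (fun i => (f i)%:R * z i ^+ 2)) => [|i]; last first.
  by case: (f i); rewrite ?mul1r ?mul0r ?expr0n.
by rewrite -bE -nE -HE.
Qed.

Let untreated_spread : b ^+ 2 <= (1 - n) * (1 - H).
Proof.
have := mean_cauchy_schwarz (fun i => 1 - (f i)%:R) (fun i => (1 - (f i)%:R) * z i).
rewrite (@eq_mean _ _ (fun i => (1 - (f i)%:R) * _) (fun i => z i + (- 1) * ((f i)%:R * z i))) => [|i]; last first.
  by case: (f i) => /=; ring.
rewrite (@eq_mean _ _ (fun i => (1 - (f i)%:R) ^+ 2) (fun i => 1 - (f i)%:R)) => [|i]; last first.
  by case: (f i) => /=; ring.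
rewrite (@eq_mean _ _ (fun i => (_ * _) ^+ 2) (fun i => (1 - (f i)%:R) * z i ^+ 2)) => [|i]; last first.
  by case: (f i) => /=; ring.
by rewrite meanD meanZ -bE -n1E -H1E z1 add0r mulN1r sqrrN.
Qed.

Let H_le : H <= Z * n.
Proof.
rewrite HE nE -meanZ; apply: le_mean => i; rewrite mulrC ler_wpM2r//.
exact: cov_deviation_le.
Qed.

Let H1_le : 1 - H <= Z * (1 - n).
Proof.
rewrite H1E n1E -meanZ; apply: le_mean => i; rewrite mulrC ler_wpM2r//.
  by case: (f i); rewrite subr_ge0.
exact: cov_deviation_le.
Qed.

Let average_effectE : average_effect gamma x = mu * gamma.
Proof.
rewrite /average_effect (@eq_mean _ _ _ (fun i => gamma * x i)) => [|i]; last by rewrite mulrC.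
by rewrite meanZ cov_mean mulrC.
Qed.

Let Z0 : 0 <= Z. Proof. by rewrite mulr_ge0// sqrtr_ge0. Qed.

(* When [B = 0] the estimate is 0 by convention and the error is [- mu * gamma], *)
(* which is why this case gets its own hypothesis. *)
Let bound_of_product (S B v M : R) : 0 <= M ->
  (B != 0 -> S * B = v) -> (B = 0 -> S ^+ 2 <= M) -> v ^+ 2 <= M * B ^+ 2 ->
  S ^+ 2 <= M.
Proof.
move=> M0 SB SB0 vM; have [/SB0//|Bn0] := eqVneq B 0.
have B2 : 0 < B ^+ 2 by rewrite exprn_even_gt0.
by rewrite -(ler_pM2r B2) -exprMn SB.
Qed.

(** For a regular design the estimate is [gamma] times the mean covariate of the
    treated units; after centring, the square of this mean is at most [Z]. *)
Lemma slr_error_product : let S := noiseless_error gamma fc E SLR f in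
  ((p + q) * (1 - p - q) != 0 ->
    S * ((p + q) * (1 - p - q)) = gamma * (1 - p - q) * b)
  /\ S ^+ 2 <= gamma ^+ 2 * (mu ^+ 2 + Z).
Proof.
move=> S; have SE : S = estimate gamma fc p x SLR f (fun=> 0) - mu * gamma.
  by rewrite /S /noiseless_error average_effectE.
rewrite (slr_estimate gamma fc p f N0 (cov_mean E)) in SE.
rewrite -/x -/z -/q -/b in SE.
have SB : (p + q) * (1 - p - q) != 0 ->
    S * ((p + q) * (1 - p - q)) = gamma * (1 - p - q) * b.
  move=> Bn0; rewrite SE mulrBl divfK//; ring.
split=> //; have g2 := sqr_ge0 gamma; have m2 := sqr_ge0 mu; have Z0' := Z0.
have M0 : 0 <= gamma ^+ 2 * (mu ^+ 2 + Z) by rewrite mulr_ge0// addr_ge0.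
apply: (bound_of_product M0 SB).
  move=> B0; rewrite SE B0 invr0 mulr0 sub0r sqrrN exprMn mulrC ler_wpM2l//.
  by rewrite lerDl.
have bb : b ^+ 2 <= Z * n ^+ 2.
  apply: (le_trans treated_spread); have := ler_wpM2l n_ge0 H_le; lra.
have e1 : Z * n ^+ 2 <= (mu ^+ 2 + Z) * n ^+ 2 by rewrite ler_wpM2r ?sqr_ge0// lerDr.
have g1 : 0 <= gamma ^+ 2 * (1 - p - q) ^+ 2 by rewrite mulr_ge0// sqr_ge0.
have := ler_wpM2l g1 (le_trans bb e1); rewrite /n; lra.
Qed.

(** With [Y = gamma * T * x] the within-group slope lies between 0 and [gamma], so
    the estimate is [gamma] times a convex combination of the treated and
    untreated mean covariates.  In the proof this appears as a bound of
    [n * (1 - n - H)], respectively of its untreated counterpart, by the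
    denominator [B], according to the sign of [1 - n - H]. *)
Lemma mlr_error_product : let S := noiseless_error gamma fc E MLR f in
  let B := (p + q) * (1 - p - q) - b ^+ 2 in
  (B != 0 -> S * B = gamma * b * (1 - 2 * p - q - h))
  /\ S ^+ 2 <= gamma ^+ 2 * (mu ^+ 2 + Z).
Proof.
move=> S B; have SE : S = estimate gamma fc p x MLR f (fun=> 0) - mu * gamma.
  by rewrite /S /noiseless_error average_effectE.
rewrite (mlr_estimate gamma fc p f N0 (cov_mean E) (cov_moment2 E)) in SE.
rewrite -/x -/z -/q -/b -/h -/B in SE.
have SB : B != 0 -> S * B = gamma * b * (1 - 2 * p - q - h).
  by move=> Bn0; rewrite SE mulrBl divfK// /B; ring.
split=> //; have g2 := sqr_ge0 gamma; have m2 := sqr_ge0 mu; have Z0' := Z0.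
have M0 : 0 <= gamma ^+ 2 * (mu ^+ 2 + Z) by rewrite mulr_ge0// addr_ge0.
apply: (bound_of_product M0 SB).
  move=> B0; rewrite SE B0 invr0 mulr0 sub0r sqrrN exprMn mulrC ler_wpM2l//.
  by rewrite lerDl.
have [n0' n1'] := (n_ge0, n_le1); have tS := treated_spread; have uS := untreated_spread.
have e : 1 - 2 * p - q - h = 1 - n - H by rewrite /n /H; ring.
have BE : B = n * (1 - n) - b ^+ 2 by rewrite /B /n; ring.
have key : b ^+ 2 * (1 - n - H) ^+ 2 <= Z * B ^+ 2.
  have [pos|neg] := leP 0 (1 - n - H).
    have nB : n * (1 - n - H) <= B by rewrite BE; lra.
    have n0s : 0 <= n * (1 - n - H) by rewrite mulr_ge0.
    have bb : b ^+ 2 <= Z * n ^+ 2 by apply: (le_trans tS); have := ler_wpM2l n0' H_le; lra.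
    have := ler_wpM2r (sqr_ge0 (1 - n - H)) bb.
    have := ler_wpM2l Z0' (ler_pM n0s n0s nB nB); lra.
  have nB : (1 - n) * (H - (1 - n)) <= B by rewrite BE; lra.
  have n0s : 0 <= (1 - n) * (H - (1 - n)) by rewrite mulr_ge0//; lra.
  have bb : b ^+ 2 <= Z * (1 - n) ^+ 2 by apply: (le_trans uS); have := ler_wpM2l n1' H1_le; lra.
  have := ler_wpM2r (sqr_ge0 (1 - n - H)) bb.
  have := ler_wpM2l Z0' (ler_pM n0s n0s nB nB); lra.
rewrite e -mulrA exprMn -[leRHS]mulrA exprMn; apply: ler_wpM2l => //.
by apply: (le_trans key); rewrite ler_wpM2r ?sqr_ge0// lerDr.
Qed.

(** The deviation of the modified covariate from its mean [k] is
    [(1 - p) * x - k] on treated units and [- p * x - k] on the others.  The product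
    of these two expressions is one quadratic polynomial of [x], bounded below in
    mean square by [mean_square_quadratic]; dividing by the largest value of the
    expression that is not realised bounds the variance [B] from below.  The
    numerator is a covariance with [z], so its square is at most [B]. *)
Lemma mcm_error_product : let S := noiseless_error gamma fc E MCM f in
  let B := p * (1 - p) * (1 + mu ^+ 2)
    + (1 - 2 * p) * (h + 2 * mu * b + mu ^+ 2 * q) - (b + mu * q) ^+ 2 in
  (B != 0 -> S * B = gamma * mu * p * (h + mu * b))
  /\ S ^+ 2 <= gamma ^+ 2 * mu ^+ 2 * p ^+ 2 / (p * (1 - p)) ^+ 2
               * (2 * ((4 + 2 * mu ^+ 2) * Num.sqrt N%:R)).
Proof.
move=> S B; have SE : S = mu * gamma_hat gamma fc p x f (fun=> 0) - mu * gamma.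
  by rewrite /S /noiseless_error average_effectE (mcm_estimate _ _ _ (cov_mean E)).
have gE := gamma_hatE gamma fc p f N0 (cov_mean E) (cov_moment2 E).
rewrite /= -/x -/z -/q -/b -/h -/B in gE; rewrite gE in SE.
have SB : B != 0 -> S * B = gamma * mu * p * (h + mu * b).
  by move=> Bn0; rewrite SE mulrBl mulrA divfK//; ring.
split=> //.
set X := (4 + 2 * mu ^+ 2) * Num.sqrt N%:R; pose al := p * (1 - p).
have al0 : 0 < al by rewrite mulr_gt0// subr_gt0.
have p0' := p0; have p1' := p1.
pose k := mean (fun i => tau i * x i).
have kE : k = b + mu * q.
  rewrite /k (@eq_mean _ _ _ (fun i => tau i * z i + mu * tau i)) => [|i]; last by rewrite /z; ring.
  by rewrite meanD meanZ.
have B_var : B = mean (fun i => (tau i * x i - k) ^+ 2).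
  rewrite (@eq_mean _ _ _ (fun i => (tau i * x i) ^+ 2 + (- 2 * k * (tau i * x i) + k ^+ 2))) => [|i]; last by ring.
  rewrite !meanD meanZ mean_cst// -/k.
  rewrite (mean_modified_covariate_sq p f N0 (cov_mean E) (cov_moment2 E)) -/x -/z -/q -/b -/h.
  by rewrite kE /B; ring.
have X_ge i : x i ^+ 2 <= X by exact: cov_sq_le.
have k2X : k ^+ 2 <= X.
  apply: le_trans (sqr_mean_le _ N0) _; rewrite -[leRHS](mean_cst X N0).
  apply: le_mean => i; apply: le_trans (X_ge i).
  by rewrite exprMn ler_piMl// sqr_ge0.
have B_low : 2 * al ^+ 2 <= 4 * X * B.
  apply: le_trans (mean_square_quadratic E N0 al ((1 - 2 * p) * k) (- k ^+ 2)) _.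
  rewrite B_var -meanZ; apply: le_mean => i.
  (* [c] is the coefficient of the treatment status that is not realised. *)
  have other (c : R) : c ^+ 2 <= 1 -> (c * x i + k) ^+ 2 <= 4 * X.
    move=> c1; have := ler_wpM2r (sqr_ge0 (x i)) c1.
    have := X_ge i; have := sqr_ge0 (c * x i - k); move: k2X; lra.
  have p2 : p ^+ 2 <= 1 by rewrite exprn_ile1// ltW.
  have pp2 : (- (1 - p)) ^+ 2 <= 1 by nra.
  rewrite -/(x i) /tau /al; case: (f i) => /=.
    have := ler_wpM2r (sqr_ge0 ((1 - p) * x i - k)) (other p p2); lra.
  have := ler_wpM2r (sqr_ge0 ((0 - p) * x i - k)) (other _ pp2); lra.
have X0 : 0 <= X by exact: le_trans (sqr_ge0 k) k2X.
have al2 : 0 < al ^+ 2 by rewrite exprn_gt0.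
have B0 : 0 < B.
  rewrite ltNge; apply/negP => Bn; have : 4 * X * B <= 0 by rewrite mulr_ge0_le0// mulr_ge0.
  lra.
have cs : (h + mu * b) ^+ 2 <= B.
  have := mean_cauchy_schwarz (fun i => tau i * x i - k) z; rewrite -B_var z2 mulr1.
  rewrite (@eq_mean _ _ _ (fun i => tau i * z i ^+ 2 + (mu * (tau i * z i) + - k * z i))) => [|i]; last by rewrite /z; ring.
  by rewrite !meanD !meanZ z1 mulr0 addr0.
have Bn0 : B != 0 by rewrite gt_eqF.
pose g := gamma ^+ 2 * mu ^+ 2 * p ^+ 2.
have g0 : 0 <= g. rewrite /g. apply: mulr_ge0; last exact: sqr_ge0. apply: mulr_ge0; exact: sqr_ge0.
have SSB : S ^+ 2 * B <= g.
  rewrite -(ler_pM2r B0) -mulrA -expr2 -exprMn SB//.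
  rewrite (_ : (_ * (h + mu * b)) ^+ 2 = g * (h + mu * b) ^+ 2); last by rewrite /g; ring.
  exact: ler_wpM2l.
rewrite -/g -/al mulrAC ler_pdivlMr//.
have := ler_wpM2l (sqr_ge0 S) B_low.
have X4 : 0 <= 4 * X by rewrite mulr_ge0.
have := ler_wpM2l X4 SSB; lra.
Qed.

End MethodErrors.

Section Linearization.
Context {R : realType}.
Variables (gamma fc p mu : R).
Hypotheses (p0 : 0 < p) (p1 : p < 1).

(** The first-order effect of one indicator on the error, as a function of the
    centred covariate of the unit. *)
Definition influence (m : method) (z : R) : R :=
  match m with
  | MCM => gamma * mu * p / (p * (1 - p) * (1 + mu ^+ 2)) * (z ^+ 2 + mu * z)
  | SLR => gamma * (1 - p) / (p * (1 - p)) * z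
  | MLR => gamma * (1 - 2 * p) / (p * (1 - p)) * z
  end.

Definition linear_error N (E : trial p mu N) (m : method) (f : {ffun 'I_N -> bool}) : R :=
  mean (fun i => influence m (cov E i - mu) * ((f i)%:R - p)).

(** The scores [q], [b] and [h] of the closed forms are those of index 0, 1 and 2. *)
Definition score N (E : trial p mu N) (k : nat) (f : {ffun 'I_N -> bool}) : R :=
  mean (fun i => (cov E i - mu) ^+ k * ((f i)%:R - p)).

Definition score_sq N (E : trial p mu N) (f : {ffun 'I_N -> bool}) : R :=
  score E 0 f ^+ 2 + score E 1 f ^+ 2 + score E 2 f ^+ 2.

(** [99 = 3 * 3 * (1 + 1 + 3 ^+ 2)]: the convexity constant of the square of a
    sum of three terms, the constant of [Ex_mean4], and the squared second moments
    of [1], [z] and [z ^+ 2]. *)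
Lemma Ex_score_sq N (E : trial p mu N) : (0 < N)%N ->
  Ex p (fun f => score_sq E f ^+ 2) <= 99 / N%:R ^+ 2.
Proof.
move=> N0; have p01 : 0 <= p <= 1 by rewrite !ltW.
have N2 : 0 < N%:R ^+ 2 :> R by rewrite exprn_gt0// ltr0n.
have := Ex_mean4 p01 N0 (fun i => (cov E i - mu) ^+ 0).
have := Ex_mean4 p01 N0 (fun i => (cov E i - mu) ^+ 1).
have := Ex_mean4 p01 N0 (fun i => (cov E i - mu) ^+ 2).
under eq_mean do rewrite -exprM. rewrite cov_moment4.
under eq_mean do rewrite expr1. rewrite cov_moment2.
under eq_mean do rewrite expr1n. rewrite mean_cst//.
move=> h2 h1 h0.
apply: (@le_trans _ _ (Ex p (fun f => 3 * (score E 0 f ^+ 4 + (score E 1 f ^+ 4 + score E 2 f ^+ 4))))).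
  apply: (le_Ex p01) => f; rewrite /score_sq.
  move: (score E 0 f) (score E 1 f) (score E 2 f) => a b c.
  have := sqr_ge0 (a ^+ 2 - b ^+ 2); have := sqr_ge0 (a ^+ 2 - c ^+ 2).
  have := sqr_ge0 (b ^+ 2 - c ^+ 2); lra.
rewrite ExZ !ExD /score; move: h0 h1 h2; set A := Ex _ _; set B := Ex _ _; set C := Ex _ _.
move: (N%:R ^+ 2)^-1 => w; lra.
Qed.

(** The constant depends neither on [N] nor on the trial, which makes all the
    limits below uniform over the trials of a given size. *)
Lemma linearization_error m : exists2 K : R, 0 <= K &
  forall N (E : trial p mu N) f, (0 < N)%N ->
  (noiseless_error gamma fc E m f - linear_error E m f) ^+ 2
  <= K * Num.sqrt N%:R * score_sq E f ^+ 2.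
Proof.
pose M0 := match m with
  | MCM => gamma ^+ 2 * mu ^+ 2 * p ^+ 2 / (p * (1 - p)) ^+ 2 * (2 * (4 + 2 * mu ^+ 2))
  | _ => gamma ^+ 2 * (mu ^+ 2 + 2) end.
pose D := match m with MCM => p * (1 - p) * (1 + mu ^+ 2) | _ => p * (1 - p) end.
pose K := delta_constant gamma mu D.
have M00 : 0 <= M0.
  have g2 := sqr_ge0 gamma; have m2 := sqr_ge0 mu.
  rewrite /M0; clear M0 D K; case: m; [|by apply: mulr_ge0 => //; lra|by apply: mulr_ge0 => //; lra].
  apply: mulr_ge0; last lra.
  have p2 := sqr_ge0 p.
  by apply: divr_ge0; [apply: mulr_ge0 => //; exact: mulr_ge0|exact: sqr_ge0].
have K0 : 0 <= K.
  rewrite /K /delta_constant divr_ge0 ?exprn_even_ge0//.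
  have C2 := sqr_ge0 (drift_bound gamma mu); have D2 := sqr_ge0 D.
  by apply: addr_ge0; apply: mulr_ge0 => //; exact: mulr_ge0.
exists (K * (1 + M0)); first by rewrite mulr_ge0// addr_ge0.
move=> N E f N0; set r := Num.sqrt N%:R.
have r1 : 1 <= r by rewrite /r -[leLHS]sqrtr1 ler_sqrt// ler1n.
have := treatment_score_le1 p0 p1 N0 f.
have := covariate_score_le1 E p0 p1 N0 f.
have s0 : score E 0 f = mean (fun i => (f i)%:R - p).
  by apply: eq_mean => i; rewrite expr0 mul1r.
have s1 : score E 1 f = mean (fun i => ((f i)%:R - p) * (cov E i - mu)).
  by apply: eq_mean => i; rewrite expr1 mulrC.
have s2 : score E 2 f = mean (fun i => ((f i)%:R - p) * (cov E i - mu) ^+ 2).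
  by apply: eq_mean => i; rewrite mulrC.
rewrite -s0 -s1 => b1 q1.
have U0 := sqr_ge0 (score_sq E f).
have finish (S L M : R) : M <= M0 * r -> (S - L) ^+ 2 <= K * (1 + M) * score_sq E f ^+ 2 ->
    (S - L) ^+ 2 <= K * (1 + M0) * r * score_sq E f ^+ 2.
  move=> MM /le_trans; apply; rewrite ler_wpM2r// -[leRHS]mulrA ler_wpM2l//; lra.
rewrite /linear_error; case: m @M0 @D @K M00 K0 finish => M0 D K M00 K0 finish /=.
- have [SB SM] := mcm_error_product gamma fc E p0 p1 N0 f.
  have := @mcm_linearization R gamma mu p (score E 0 f) (score E 1 f) (score E 2 f) p0 p1 q1 b1 _ _ SM.
  rewrite -s0 -s1 -s2 in SB *.
  move=> /(_ SB) h.
  rewrite (_ : mean _ = gamma * mu * p * (score E 2 f + mu * score E 1 f) / D).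
    apply: finish h; rewrite /M0 -/r; lra.
  rewrite s2 s1 (@eq_mean _ _ _ (fun i => gamma * mu * p / D * (((f i)%:R - p) * (cov E i - mu) ^+ 2)
     + gamma * mu * p / D * mu * (((f i)%:R - p) * (cov E i - mu)))) => [|i]; last by rewrite -/D; ring.
  by rewrite meanD !meanZ; ring.
- have [SB SM] := slr_error_product gamma fc E N0 f.
  rewrite -s0 -s1 in SB *.
  have h := slr_linearization mu (score E 2 f) p0 p1 q1 b1 SM SB.
  rewrite (_ : mean _ = gamma * (1 - p) * score E 1 f / D).
    apply: finish h; rewrite /M0 -/r -mulrA ler_wpM2l ?sqr_ge0//.
    by have := ler_wpM2l (sqr_ge0 mu) r1; lra.
  rewrite s1 (@eq_mean _ _ _ (fun i => gamma * (1 - p) / D * (((f i)%:R - p) * (cov E i - mu)))) => [|i]; last by rewrite -/D; ring.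
  by rewrite meanZ; ring.
- have [SB SM] := mlr_error_product gamma fc E N0 f.
  rewrite -s0 -s1 -s2 in SB *.
  have h := mlr_linearization mu p0 p1 q1 b1 SM SB.
  rewrite (_ : mean _ = gamma * (1 - 2 * p) * score E 1 f / D).
    apply: finish h; rewrite /M0 -/r -mulrA ler_wpM2l ?sqr_ge0//.
    by have := ler_wpM2l (sqr_ge0 mu) r1; lra.
  rewrite s1 (@eq_mean _ _ _ (fun i => gamma * (1 - 2 * p) / D * (((f i)%:R - p) * (cov E i - mu)))) => [|i]; last by rewrite -/D; ring.
  by rewrite meanZ; ring.
Qed.

End Linearization.

(** * Limits of the variances *)

Section MethodWeight.
Context {R : realType}.
Variable mu : R.

(** The square root of the coefficient of [p ^+ 2] in the variance of MCM, so that
    the three variances are, up to a common factor, squares of affine functions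
    of [p]. *)
Definition mcm_ratio : R := Num.sqrt (mu ^+ 2 * (3 + mu ^+ 2)) / (1 + mu ^+ 2).

(** The approximate variances without their common factor. *)
Definition method_weight (p : R) (m : method) : R :=
  match m with
  | MCM => (mcm_ratio * p) ^+ 2
  | SLR => (1 - p) ^+ 2
  | MLR => (2 * p - 1) ^+ 2
  end.

Let mu1 : 0 < 1 + mu ^+ 2. Proof. by rewrite ltr_wpDr ?sqr_ge0. Qed.

Lemma mcm_ratio_sq : mcm_ratio ^+ 2 * (1 + mu ^+ 2) ^+ 2 = mu ^+ 2 * (3 + mu ^+ 2).
Proof.
rewrite -exprMn divfK ?gt_eqF// sqr_sqrtr// mulr_ge0 ?sqr_ge0//.
by rewrite addr_ge0 ?sqr_ge0.
Qed.

Lemma approx_variance_weight gamma p N m : 0 < p < 1 -> (0 < N)%N ->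
  approx_variance gamma mu p N m = gamma ^+ 2 / (p * (1 - p) * N%:R) * method_weight p m.
Proof.
move=> /andP[p0 p1] N0; have Nn0 : N%:R != 0 :> R by rewrite pnatr_eq0 -lt0n.
have pn0 : p != 0 by rewrite gt_eqF.
have p1n0 : 1 - p != 0 by rewrite gt_eqF// subr_gt0.
have mun0 : 1 + mu ^+ 2 != 0 by rewrite gt_eqF.
case: m => /=; first last.
- by field; rewrite p1n0 pn0 Nn0.
- by field; rewrite p1n0 pn0 Nn0.
rewrite exprMn (_ : mcm_ratio ^+ 2 = mu ^+ 2 * (3 + mu ^+ 2) / (1 + mu ^+ 2) ^+ 2).
  by field; rewrite mun0 p1n0 pn0 Nn0.
by rewrite -mcm_ratio_sq mulfK// expf_neq0.
Qed.

Lemma method_weight_ge0 p m : 0 <= method_weight p m.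
Proof. by case: m => /=; exact: sqr_ge0. Qed.

End MethodWeight.

Section VarianceLimit.
Context {R : realType}.
Variables (gamma fc p mu : R).
Hypotheses (p0 : 0 < p) (p1 : p < 1).
Let p01 : 0 <= p <= 1. Proof. by rewrite !ltW. Qed.
Let pp0 : 0 < p * (1 - p). Proof. by rewrite mulr_gt0 ?subr_gt0. Qed.

Definition noiseless_variance N (E : trial p mu N) (m : method) : R :=
  Ex p (fun f => (noiseless_error gamma fc E m f
                  - Ex p (noiseless_error gamma fc E m)) ^+ 2).

Lemma Ex_linear_error N (E : trial p mu N) m : (0 < N)%N ->
  Ex p (linear_error gamma E m) = 0.
Proof. by move=> N0; exact: Ex_mean. Qed.

(** The delta-method formulas are the exact variances of the linear parts. *)
Lemma approx_varianceE N (E : trial p mu N) m : (0 < N)%N ->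
  Ex p (fun f => linear_error gamma E m f ^+ 2) = approx_variance gamma mu p N m.
Proof.
move=> N0; rewrite (Ex_mean2 N0).
have Nn0 : N%:R != 0 :> R by rewrite pnatr_eq0 -lt0n.
have pn0 : p != 0 by rewrite gt_eqF.
have p1n0 : 1 - p != 0 by rewrite gt_eqF// subr_gt0.
have mun0 : 1 + mu ^+ 2 != 0 by rewrite gt_eqF// ltr_wpDr ?sqr_ge0.
case: m => /=.
- rewrite (@eq_mean _ _ _ (fun i => (gamma * mu * p / (p * (1 - p) * (1 + mu ^+ 2))) ^+ 2
    * ((cov E i - mu) ^+ 4 + (2 * mu * (cov E i - mu) ^+ 3 + mu ^+ 2 * (cov E i - mu) ^+ 2)))) => [|i]; last by ring.
  rewrite meanZ !meanD !meanZ cov_moment2 cov_moment3 cov_moment4.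
  by field; rewrite pn0 p1n0 mun0 Nn0.
- rewrite (@eq_mean _ _ _ (fun i => (gamma * (1 - p) / (p * (1 - p))) ^+ 2
    * (cov E i - mu) ^+ 2)) => [|i]; last by ring.
  by rewrite meanZ cov_moment2; field; rewrite pn0 p1n0 Nn0.
- rewrite (@eq_mean _ _ _ (fun i => (gamma * (1 - 2 * p) / (p * (1 - p))) ^+ 2
    * (cov E i - mu) ^+ 2)) => [|i]; last by ring.
  by rewrite meanZ cov_moment2; field; rewrite pn0 p1n0 Nn0.
Qed.

Lemma approx_variance_scale N m : (0 < N)%N ->
  N%:R * approx_variance gamma mu p N m = approx_variance gamma mu p 1 m.
Proof.
move=> N0; have Nn0 : N%:R != 0 :> R by rewrite pnatr_eq0 -lt0n.
rewrite !approx_variance_weight ?p0//; field.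
by rewrite Nn0 (gt_eqF p0) gt_eqF// subr_gt0.
Qed.

Lemma approx_variance_ge0 m : 0 <= approx_variance gamma mu p 1 m.
Proof.
rewrite approx_variance_weight ?p0// mulr_ge0 ?method_weight_ge0//.
by rewrite divr_ge0 ?sqr_ge0// mulr1 ltW.
Qed.

(** With [theta] in [variance_comparison] proportional to [eps], the part of the
    bound proportional to the limit variance is at most [eps / 2]; the part
    coming from the linearization error is [A / sqrt N]. *)
Lemma noiseless_variance_limit m (eps : R) : 0 < eps ->
  \forall N \near \oo, forall E : trial p mu N,
    N%:R * `|noiseless_variance E m - approx_variance gamma mu p N m| <= eps.
Proof.
move=> eps0; have [K K0 KE] := linearization_error gamma fc mu p0 p1 m.
pose v := approx_variance gamma mu p 1 m.
have v0 : 0 <= v by exact: approx_variance_ge0.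
pose theta := eps / (2 * (v + 1)).
have th0 : 0 < theta by rewrite divr_gt0// mulr_gt0// ltr_wpDl.
pose A := (1 + theta^-1) * K * 99.
have A0 : 0 <= A by rewrite !mulr_ge0// addr_ge0// invr_ge0 ltW.
pose T := 2 * A / eps + 1.
have T0 : 0 < T by apply: ltr_wpDl => //; apply: divr_ge0; [exact: mulr_ge0|exact: ltW].
near=> N => E.
have N0 : (0 < N)%N by near: N; exact: nbhs_infty_gt.
have NT : T ^+ 2 <= N%:R :> R by near: N; exact: nbhs_infty_ger.
set r := Num.sqrt N%:R : R.
have rN : r * r = N%:R by rewrite -expr2 sqr_sqrtr.
have rT : T <= r by rewrite /r -(ger0_norm (ltW T0)) -sqrtr_sqr ler_wsqrtr.
have r0 : 0 < r by exact: lt_le_trans rT.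
have := variance_comparison p01 (noiseless_error gamma fc E m) th0 (Ex_linear_error E m N0).
rewrite approx_varianceE// -/(noiseless_variance E m).
have errE : Ex p (fun f => (noiseless_error gamma fc E m f - linear_error gamma E m f) ^+ 2)
    <= K * r * (99 / N%:R ^+ 2).
  apply: (@le_trans _ _ (Ex p (fun f => K * r * score_sq E f ^+ 2))).
    by apply: (le_Ex p01) => f; exact: KE.
  by rewrite ExZ ler_wpM2l ?Ex_score_sq// mulr_ge0// ltW.
have t1 : 0 <= 1 + theta^-1 by rewrite addr_ge0// invr_ge0 ltW.
have {}errE := ler_wpM2l t1 errE.
move=> /le_trans /(_ (lerD (lexx _) errE)) h.
apply: (le_trans (ler_wpM2l (ler0n R N) h)).
have Nn0 : N%:R != 0 :> R by rewrite pnatr_eq0 -lt0n.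
have rn0 : r != 0 by rewrite gt_eqF.
have -> : N%:R * (theta * approx_variance gamma mu p N m
   + (1 + theta^-1) * (K * r * (99 / N%:R ^+ 2))) = theta * v + A / r.
  rewrite mulrDr mulrCA approx_variance_scale// -/v; congr (_ + _).
  rewrite -rN /A; move: theta^-1 => w; field; exact: rn0.
have th_v : theta * v <= eps / 2.
  rewrite /theta (_ : eps / 2 = eps / (2 * (v + 1)) * (v + 1)).
    by rewrite ler_wpM2l// ?lerDl// ltW.
  by field; rewrite gt_eqF// ltr_wpDl.
have A_r : A / r <= eps / 2.
  rewrite ler_pdivrMr//; apply: (@le_trans _ _ (eps / 2 * T)).
    rewrite /T (_ : eps / 2 * _ = A + eps / 2); last by field; rewrite gt_eqF.
    by rewrite lerDl divr_ge0// ltW.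
  by rewrite ler_wpM2l// divr_ge0// ltW.
lra.
Unshelve. all: end_near. Qed.

(** A third of the gap between the limits leaves room for both errors. *)
Lemma noiseless_variance_lt m m' :
  approx_variance gamma mu p 1 m < approx_variance gamma mu p 1 m' ->
  \forall N \near \oo, forall E : trial p mu N,
    noiseless_variance E m < noiseless_variance E m'.
Proof.
move=> lt; pose eps := (approx_variance gamma mu p 1 m' - approx_variance gamma mu p 1 m) / 3.
have eps0 : 0 < eps by rewrite divr_gt0// subr_gt0.
near=> N => E.
have N0 : (0 < N)%N by near: N; exact: nbhs_infty_gt.
have h : N%:R * `|noiseless_variance E m - approx_variance gamma mu p N m| <= eps.
  by move: E; near: N; exact: noiseless_variance_limit.
have h' : N%:R * `|noiseless_variance E m' - approx_variance gamma mu p N m'| <= eps.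
  by move: E {h}; near: N; exact: noiseless_variance_limit.
have Npos : 0 < N%:R :> R by rewrite ltr0n.
rewrite -(ltr_pM2l Npos).
have absE (x y : R) : N%:R * `|x - y| = `|N%:R * x - N%:R * y|.
  by rewrite -mulrBr normrM (gtr0_norm Npos).
move: h h'; rewrite !absE !approx_variance_scale// !ler_norml => /andP[_ h] /andP[h' _].
move: h h'; rewrite /eps; lra.
Unshelve. all: end_near. Qed.

End VarianceLimit.

(** Without treatment effect the averaged response is constant, so that all the
    estimates are exactly 0; this is the case of ties. *)
Lemma noiseless_error_no_effect (R : realType) (fc p mu : R) N (E : trial p mu N) m f :
  (0 < N)%N -> noiseless_error 0 fc E m f = 0.
Proof.
move=> N0; rewrite /noiseless_error /average_effect (@eq_mean _ _ _ (fun i => 0 * cov E i)) => [|i]; last first.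
  by rewrite mulrC.
rewrite meanZ mul0r subr0; case: m.
- by rewrite (mcm_estimate _ _ _ (cov_mean E)) (gamma_hatE _ _ _ _ N0 (cov_mean E) (cov_moment2 E)) !mul0r mulr0.
- by rewrite (slr_estimate _ _ _ _ N0 (cov_mean E)) !mul0r.
- by rewrite (mlr_estimate _ _ _ _ N0 (cov_mean E) (cov_moment2 E)) !mul0r.
Qed.

Section Best.
Context {R : realType}.
Variable mu : R.

Lemma best_of_weight gamma fc p m : 0 < p < 1 ->
  (forall m', m' <> m -> method_weight mu p m < method_weight mu p m') ->
  best_approx mu gamma p m /\ best_exact mu gamma fc p m.
Proof.
move=> p01 wlt; have /andP[p0 p1] := p01.
have p01' : 0 <= p <= 1 by rewrite !ltW.
have alt N m' : gamma != 0 -> (0 < N)%N -> m' <> m ->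
    approx_variance gamma mu p N m < approx_variance gamma mu p N m'.
  move=> g0 N0 mm'; rewrite !approx_variance_weight// ltr_pM2l; first exact: wlt.
  by rewrite divr_gt0 ?exprn_even_gt0// !mulr_gt0 ?subr_gt0// ltr0n.
have [->|g0] := eqVneq gamma 0.
  split=> [N m' N0 _|].
    by rewrite eqxx /= !approx_variance_weight// expr0n /= !mul0r.
  near=> N => E m' _; have N0 : (0 < N)%N by near: N; exact: nbhs_infty_gt.
  have var0 m0 : error_variance E 0 fc m0 = 0%:E.
    rewrite error_varianceE//; congr EFin.
    have -> : noiseless_error 0 fc E m0 = fun=> 0.
      by apply/funext => f; exact: noiseless_error_no_effect.
    by rewrite !Ex_cst// subrr expr0n.
  by rewrite !var0 eqxx /=.
split=> [N m' N0 mm'|]; first by rewrite (negbTE g0) /=; exact: alt.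
have lt m' : m' <> m -> \forall N \near \oo, forall E : trial p mu N,
    noiseless_variance gamma fc E m < noiseless_variance gamma fc E m'.
  by move=> mm'; apply: noiseless_variance_lt => //; exact: alt.
have all_lt : \forall N \near \oo, forall m', m' <> m -> forall E : trial p mu N,
    noiseless_variance gamma fc E m < noiseless_variance gamma fc E m'.
  have lt' m' : \forall N \near \oo, m' <> m -> forall E : trial p mu N,
      noiseless_variance gamma fc E m < noiseless_variance gamma fc E m'.
    have [mm'|mm'] := pselect (m' = m); first by apply: nearW => N /(_ mm').
    by apply: filterS (lt _ mm') => N h _.
  by apply: filterS3 (lt' MCM) (lt' SLR) (lt' MLR) => N h1 h2 h3 [].
apply: filterS all_lt => N h E m' mm'.
by rewrite (negbTE g0) /= !error_varianceE// lte_fin; exact: h.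
Unshelve. all: end_near. Qed.

End Best.

(** * Thresholds *)

Section Thresholds.
Context {R : realType}.
Variable mu : R.
Hypothesis mu_neq0 : mu != 0.
Local Notation r := (mcm_ratio mu).

Lemma mcm_ratio_gt0 : 0 < r.
Proof.
rewrite divr_gt0 ?ltr_wpDr ?sqr_ge0//.
by rewrite sqrtr_gt0 mulr_gt0 ?exprn_even_gt0// ltr_wpDr ?sqr_ge0.
Qed.

(** Ensures that the line [r * p] crosses [2 * p - 1] at the positive point
    [(2 - r)^-1]. *)
Lemma mcm_ratio_lt2 : r < 2.
Proof.
have r0 := mcm_ratio_gt0; have := mcm_ratio_sq mu; rewrite ltNge => e.
apply/negP => r2; have m2 := sqr_ge0 mu.
have r4 : 4 <= r ^+ 2 by have := ler_pM _ _ r2 r2; lra.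
have := ler_wpM2r (sqr_ge0 (1 + mu ^+ 2)) r4; rewrite e.
have := sqr_ge0 (mu ^+ 2); lra.
Qed.

(** The hypothesis is [4 * r ^+ 2 >= 1] cleared of denominators: [r * p] then meets
    [1 - p] no later than [2 * p - 1] does, at [2 / 3]. *)
Lemma mcm_ratio_ge_half : 1 <= 10 * mu ^+ 2 + 3 * mu ^+ 4 -> 1 <= 2 * r.
Proof.
move=> h; have r0 := mcm_ratio_gt0; have e := mcm_ratio_sq mu.
rewrite leNgt; apply/negP => r2.
have s0 : 0 < (1 + mu ^+ 2) ^+ 2 by rewrite exprn_gt0// ltr_wpDr ?sqr_ge0.
have r4 : 4 * r ^+ 2 < 1 by nra.
have : 4 * r ^+ 2 * (1 + mu ^+ 2) ^+ 2 < 1 * (1 + mu ^+ 2) ^+ 2 by rewrite ltr_pM2r.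
rewrite -mulrA e; move: h; lra.
Qed.

Let lt_sq (a b : R) : 0 < (b - a) * (b + a) -> a ^+ 2 < b ^+ 2.
Proof. by move=> h; rewrite -subr_gt0 subr_sqr. Qed.

Lemma mcm_lightest p m' : 0 < p < 1 ->
  p * (2 + r) < 1 \/ 1 < p * (2 - r) /\ p * (1 + r) < 1 ->
  m' <> MCM -> method_weight mu p MCM < method_weight mu p m'.
Proof.
move=> /andP[p0 p1] h mm; have r0 := mcm_ratio_gt0; have rp := mulr_gt0 r0 p0.
case: m' mm => //= _; apply: lt_sq.
  by apply: mulr_gt0; case: h => [|[]]; lra.
by case: h => [h|[h1 h2]]; [rewrite -mulrNN|]; apply: mulr_gt0; lra.
Qed.

Lemma mlr_lightest p m' : 0 < p < 1 ->
  1 < p * (2 + r) -> p * (2 - r) < 1 -> p * 3 < 2 ->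
  m' <> MLR -> method_weight mu p MLR < method_weight mu p m'.
Proof.
move=> /andP[p0 p1] h1 h2 h3 mm; have r0 := mcm_ratio_gt0.
by case: m' mm => //= _; apply: lt_sq; apply: mulr_gt0; lra.
Qed.

Lemma slr_lightest p m' : 0 < p < 1 ->
  1 < p * (1 + r) -> 2 < p * 3 ->
  m' <> SLR -> method_weight mu p SLR < method_weight mu p m'.
Proof.
move=> /andP[p0 p1] h1 h3 mm; have r0 := mcm_ratio_gt0; have rp := mulr_gt0 r0 p0.
by case: m' mm => //= _; apply: lt_sq; apply: mulr_gt0; lra.
Qed.

End Thresholds.

Theorem mainTheorem2 (R : realType) (mu : R) (mu_neq0 : mu != 0) :
  (forall gamma fc p : R, 0 < p < 1 ->
     (forall (N : nat) (E : trial p mu N),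
        error_variance E gamma fc MCM
        = treatment_variance E (fun t e =>
            (gamma_hat gamma fc p (cov E) t e - gamma)
            * ((\sum_(i < N) cov E i) / N%:R)))
     /\ (forall (m : method) (eps : R), 0 < eps ->
           \forall N \near \oo, forall E : trial p mu N,
             (`| N%:R%:E * (error_variance E gamma fc m
                            - (approx_variance gamma mu p N m)%:E) |
              <= eps%:E)%E))
  /\ (exists p1 p2 p3 : R,
        [/\ 0 < p1, p1 < p2, p2 <= p3, p3 < 1
          & 1 <= 10 * mu ^+ 2 + 3 * mu ^+ 4 -> p2 = p3]
        /\ (forall gamma fc p : R, 0 < p < 1 ->
              [/\ p < p1 ->
                    best_approx mu gamma p MCM /\ best_exact mu gamma fc p MCM,
                  p1 < p < p2 ->
                    best_approx mu gamma p MLR /\ best_exact mu gamma fc p MLR,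
                  p2 < p < p3 ->
                    best_approx mu gamma p MCM /\ best_exact mu gamma fc p MCM
                & p3 < p ->
                    best_approx mu gamma p SLR
                    /\ best_exact mu gamma fc p SLR])).
Proof.
split=> [gamma fc p p01|].
  have /andP[p0 p1] := p01; have p01' : 0 <= p <= 1 by rewrite !ltW.
  split=> [N E|m eps eps0].
    congr treatment_variance; apply/funext => t; apply/funext => e.
    rewrite (mcm_estimate _ _ _ (cov_mean E)) -[_ / N%:R]/(mean (cov E)) cov_mean.
    rewrite /average_effect (@eq_mean _ _ _ (fun i => gamma * cov E i)) => [|i]; last by rewrite mulrC.
    by rewrite meanZ cov_mean; ring.
  apply: filterS (noiseless_variance_limit gamma fc mu p0 p1 m eps0) => N h E.
  rewrite error_varianceE// -EFinB -EFinM /= lee_fin normrM ger0_norm//.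
  exact: h.
have r0 := mcm_ratio_gt0 mu_neq0; have r2 := mcm_ratio_lt2 mu_neq0.
set r := mcm_ratio mu in r0 r2.
have [half|small] := leP 1 (2 * r).
(* Here MLR and SLR exchange at [2 / 3], and MCM does not beat SLR beyond it. *)
- exists (2 + r)^-1, (2 / 3), (2 / 3); split.
    split=> //; [by rewrite invr_gt0; lra| |lra].
    by rewrite -[_^-1]mul1r ltr_pdivrMr; lra.
  move=> gamma fc p p01; have /andP[p0 p1] := p01; split.
  + move=> h; apply: best_of_weight => // m'; apply: mcm_lightest => //; left.
    by rewrite -/r -ltr_pdivlMr ?mul1r//; lra.
  + move=> /andP[h1 h2]; apply: best_of_weight => // m'.
    apply: mlr_lightest => //; rewrite -/r.
    * by rewrite -ltr_pdivrMr ?mul1r//; lra.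
    * nra.
    * lra.
  + by move=> /andP[h1 h2]; have := lt_trans h1 h2; rewrite ltxx.
  + move=> h; apply: best_of_weight => // m'; apply: slr_lightest => //; rewrite -/r; first nra.
    lra.
(* Here MCM overtakes MLR again before SLR does. *)
- exists (2 + r)^-1, (2 - r)^-1, (1 + r)^-1; split.
    have r2p : 0 < 2 - r by lra.
    split.
    + by rewrite invr_gt0; lra.
    + by rewrite ltf_pV2 ?posrE; lra.
    + by rewrite lef_pV2 ?posrE; lra.
    + by rewrite invf_lt1; lra.
    + by move=> /(mcm_ratio_ge_half mu_neq0); rewrite -/r; lra.
  move=> gamma fc p p01; have /andP[p0 p1] := p01; split.
  + move=> h; apply: best_of_weight => // m'; apply: mcm_lightest => //; left.
    by rewrite -/r -ltr_pdivlMr ?mul1r//; lra.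
  + move=> /andP[h1 h2]; apply: best_of_weight => // m'.
    have h3 : p * (2 - r) < 1 by rewrite -ltr_pdivlMr ?mul1r//; lra.
    apply: mlr_lightest => //; rewrite -/r.
    * by rewrite -ltr_pdivrMr ?mul1r//; lra.
    * nra.
  + move=> /andP[h1 h2]; apply: best_of_weight => // m'; apply: mcm_lightest => //; right.
    by rewrite -/r; split; [rewrite -ltr_pdivrMr ?mul1r//|rewrite -ltr_pdivlMr ?mul1r//]; lra.
  + move=> h; apply: best_of_weight => // m'.
    have h1 : 1 < p * (1 + r) by rewrite -ltr_pdivrMr ?mul1r//; lra.
    by apply: slr_lightest => //; rewrite -/r; nra.
Qed.
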